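(* Let $d\geq 2$, let $J$ be an irreducible and resilient kernel on $\mathbb{Z}^d$, and let $\beta\ge 0$ with $\beta \neq \beta_c(J)$. Let $(J_n)_{n\in \mathbb{N}}$ be a sequence of kernels converging to $J$ in $L_1$, and let $(\beta_n)_{n\in \mathbb{N}} \subset (0,\infty)$ be such that $\lim_{n \to \infty}\beta_n = \beta$. Then $$\lim_{n\to \infty} \theta(\beta_n, J_n) = \theta(\beta,J).$$
   Context: $\|\cdot\|$ is the Euclidean norm, $\mathbf 0$ the origin. A kernel is a function $J:\mathbb{Z}^d\to[0,\infty)$ (the value at $\mathbf 0$ being irrelevant) which, as standing assumptions, is symmetric ($J(x)$ is invariant under sign flips and permutations of the coordinates of $x$) and integrable ($\sum_{x}J(x)<\infty$). It is irreducible if for every $x\in\mathbb{Z}^d$ there are $\mathbf{0}=a_0,\ldots,a_n=x$ in $\mathbb{Z}^d$ with $J(a_i-a_{i-1})>0$ for all $i\in\{1,\dots,n\}$. Under $\mathbb{P}_{\beta,J}$, each edge $\{x,y\}$ with $x\neq y\in\mathbb{Z}^d$ is open with probability $1-e^{-\beta J(x-y)}$, independently of all other edges. $K_x$ is the open cluster of $x$, $\theta(\beta,J)=\mathbb{P}_{\beta,J}(|K_{\mathbf 0}|=\infty)$ and $\beta_c(J)=\inf\{\beta\ge0:\theta(\beta,J)>0\}$. $J$ is resilient if for all $\beta>\beta_c(J)$ there exists $N\in\mathbb{N}$ such that $\tilde J(x)=J(x)\mathbf{1}_{\{\|x\|\le N\}}$ satisfies $\mathbb{P}_{\beta,\tilde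 J}(|K_{\mathbf 0}|=\infty)>0$. $J_n\to J$ in $L_1$ means $\sum_{x\in\mathbb{Z}^d}|J_n(x)-J(x)|\to0$. *)

(* Defs.v *)
From HB Require Import structures.
From mathcomp Require Import all_boot all_order all_algebra all_fingroup finmap.
From mathcomp Require Import all_classical all_reals all_analysis.
From mathcomp Require Import ring.

Set Implicit Arguments.
Unset Strict Implicit.
Unset Printing Implicit Defensive.

Import Order.TTheory GRing.Theory Num.Theory.
Import numFieldNormedType.Exports.

Local Open Scope classical_set_scope.
Local Open Scope ring_scope.

Definition lattice (d : nat) := 'rV[int]_d.

Definition flip_signs (d : nat) (b : 'I_d -> bool) (x : lattice d) : lattice d :=
  \row_i (if b i then - x 0 i else x 0 i).

Definition enorm (R : realType) (d : nat) (x : lattice d) : R :=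
  Num.sqrt (\sum_(i < d) ((x 0 i)%:~R ^+ 2)).

Record is_kernel (R : realType) (d : nat) (J : lattice d -> R) : Prop := {
  kernel_ge0 : forall x, 0 <= J x ;
  kernel_perm : forall (s : 'S_d) x, J (col_perm s x) = J x ;
  kernel_flip : forall (b : 'I_d -> bool) x, J (flip_signs b x) = J x ;
  kernel_integrable : (\esum_(x in [set: lattice d]) (J x)%:E < +oo)%E }.

Definition irreducible (R : realType) (d : nat) (J : lattice d -> R) : Prop :=
  forall x, exists (n : nat) (a : nat -> lattice d),
    [/\ a 0%N = 0, a n = x &
        forall i : nat, (1 <= i <= n)%N -> 0 < J (a i - a i.-1)].

Definition truncation (R : realType) (d : nat) (J : lattice d -> R) (N : nat) :
  lattice d -> R := fun x => if enorm R x <= N%:R then J x else 0.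

Definition cvg_L1 (R : realType) (d : nat) (J_ : nat -> lattice d -> R)
    (J : lattice d -> R) : Prop :=
  (\esum_(x in [set: lattice d]) `|J_ n x - J x|%:E)%E @[n --> \oo] --> 0%E.

(* Unordered pairs {x, y} with x != y. *)
Definition edge (d : nat) := {e : {fset lattice d} | #|` e| == 2%N}.

Definition is_edge (d : nat) (e : edge d) (x y : lattice d) : Prop :=
  val e = [fset x; y]%fset.

Definition open_event (d : nat) (e : edge d) : set (edge d -> bool) :=
  [set w | w e].

(* {0,1}^E with the product sigma-algebra; [w e] means that [e] is open. *)
Definition config (d : nat) :=
  g_sigma_algebraType [set open_event e | e in [set: edge d]].

Definition connected_in (d : nat) (w : config d) (x y : lattice d) : Prop :=
  exists s : seq (lattice d),
    path (fun u v => `[< exists2 e : edge d, is_edge e u v & w e >]) x s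
    /\ last x s = y.

Definition open_cluster (d : nat) (w : config d) (x : lattice d) : set (lattice d) :=
  [set y | connected_in w x y].

Definition mutually_independent (R : realType) (disp : measure_display)
    (T : measurableType disp) (P : probability T R) (I : choiceType)
    (A : I -> set T) : Prop :=
  forall F : {fset I},
    P (\bigcap_(i in [set` F]) A i) = (\prod_(i <- F) P (A i))%E.

Definition is_percolation_law (R : realType) (d : nat) (beta : R)
    (J : lattice d -> R) (P : probability (config d) R) : Prop :=
  (forall (e : edge d) x y, is_edge e x y ->
     P (open_event e) = (1 - expR (- (beta * J (x - y))))%:E) /\
  mutually_independent P (fun e : edge d => open_event e : set (config d)).

Definition percolation_law (R : realType) (d : nat) (beta : R)
    (J : lattice d -> R) : probability (config d) R :=
  get [set P | is_percolation_law beta J P].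

Definition theta (R : realType) (d : nat) (beta : R) (J : lattice d -> R) : R :=
  fine (percolation_law beta J
          [set w : config d | infinite_set (open_cluster w 0)]).

Definition beta_c (R : realType) (d : nat) (J : lattice d -> R) : \bar R :=
  ereal_inf [set b%:E | b in [set b : R | 0 <= b /\ 0 < theta b J]].

Definition resilient (R : realType) (d : nat) (J : lattice d -> R) : Prop :=
  forall beta : R, (beta_c J < beta%:E)%E ->
    exists N : nat, 0 < theta beta (truncation J N).

(* The rest of the file shows that the definition of [theta] is meaningful for
   every kernel [J] and every [0 <= beta]: the infinite-cluster event is
   measurable, and [is_percolation_law beta J] has exactly one solution, so
   [get] never returns its default value. *)

Section nested_intervals.
Context {R : realType}.
Implicit Types (p : nat -> R) (a w x : R) (F : pred nat).

(* If x is uniform on [a, a + w[, then the bits [digit a w p n x], n >= 0, are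
   independent and the n-th one is true with probability [p n]. *)
Fixpoint digit a w p n x : bool :=
  if n is n'.+1 then
    if x < a + p 0%N * w then digit a (p 0%N * w) (p \o S) n' x
    else digit (a + p 0%N * w) ((1 - p 0%N) * w) (p \o S) n' x
  else x < a + p 0%N * w.

Definition digit_set a w p F n : set (measurableTypeR R) :=
  [set x | a <= x < a + w /\ forall i, (i < n)%N -> F i -> digit a w p i x].

Lemma digit_setS a w p F n : 0 <= p 0%N <= 1 -> 0 <= w ->
  digit_set a w p F n.+1 =
  digit_set a (p 0%N * w) (p \o S) (F \o S) n `|`
  (if F 0%N then set0
   else digit_set (a + p 0%N * w) ((1 - p 0%N) * w) (p \o S) (F \o S) n).
Proof.
move=> /andP[p0 p1] w0.
have pw0 : 0 <= p 0%N * w by rewrite mulr_ge0.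
have pw1 : p 0%N * w <= w by rewrite ler_piMl.
have e : a + p 0%N * w + (1 - p 0%N) * w = a + w by ring.
apply/seteqP; split=> x.
  move=> [/andP[ax xw] H]; have [xp|px] := ltP x (a + p 0%N * w).
    left; split; first by rewrite ax.
    by move=> i lin Fi; have := H i.+1 lin Fi; rewrite /= xp.
  right; case: ifPn => [F0|nF0].
    by have := H 0%N erefl F0; rewrite /= ltNge px.
  split; first by rewrite px e.
  by move=> i lin Fi; have := H i.+1 lin Fi; rewrite /= ltNge px.
case=> [[/andP[ax xw] H]|].
  split; first by rewrite ax (lt_le_trans xw)// lerD2l.
  case=> [//|i] lin Fi /=; rewrite xw; exact: H.
case: ifPn => // nF0 [/andP[ax xw] H]; rewrite e in xw.
split; first by rewrite xw (le_trans _ ax)// lerDl.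
case=> [|i] lin Fi /=; first by rewrite Fi in nF0.
by rewrite ltNge ax; apply: H.
Qed.

Lemma digit_setP a w p F n : (forall i, 0 <= p i <= 1) -> 0 <= w ->
  measurable (digit_set a w p F n) /\
  lebesgue_measure (digit_set a w p F n) =
    (w * \prod_(i < n) (if F i then p i else 1))%:E.
Proof.
elim: n a w p F => [|n IHn] a w p F hp w0.
  have -> : digit_set a w p F 0 = `[a, (a + w)[%classic.
    apply/seteqP; split=> x /=; rewrite in_itv/=; first by move=> [].
    by move=> H; split.
  split; first exact: measurable_itv.
  rewrite lebesgue_measure_itv/= lte_fin big_ord0 mulr1.
  case: ifPn; first by rewrite -EFinB addrAC subrr add0r.
  by rewrite ltrDl -leNgt => w0'; congr EFin; apply/le_anti/andP.
rewrite digit_setS// big_ord_recl.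
have /andP[p0 p1] := hp 0%N.
have [mA lA] := IHn a (p 0%N * w) (p \o S) (F \o S) (fun i => hp i.+1)
  (mulr_ge0 p0 w0).
case: ifPn => F0; first by rewrite setU0; split=> //; rewrite lA mulrCA mulrA.
have q0 : 0 <= 1 - p 0%N by rewrite subr_ge0.
have [mB lB] := IHn (a + p 0%N * w) ((1 - p 0%N) * w) (p \o S) (F \o S)
  (fun i => hp i.+1) (mulr_ge0 q0 w0).
split; first exact: measurableU.
have dAB : digit_set a (p 0%N * w) (p \o S) (F \o S) n `&`
    digit_set (a + p 0%N * w) ((1 - p 0%N) * w) (p \o S) (F \o S) n = set0.
  apply/seteqP; split=> x // [[/andP[_ xa] _] [/andP[ax _] _]].
  by move: (lt_le_trans xa ax); rewrite ltxx.
rewrite measureU// [X in (X + _)%E]lA [X in (_ + X)%E]lB -EFinD.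
congr EFin; rewrite /= mul1r -mulrDl; congr (_ * _).
by ring.
Qed.

End nested_intervals.

Section percolation_law_existence.
Context {R : realType} (d : nat) (q : edge d -> R).
Hypothesis q01 : forall e, 0 <= q e <= 1.

Let p (n : nat) : R := if @choice.unpickle (edge d) n is Some e then q e else 0.

Let p01 n : 0 <= p n <= 1.
Proof. by rewrite /p; case: choice.unpickle => [e|]; rewrite ?lexx ?ler01 ?q01. Qed.

Let X (x : measurableTypeR R) : config d := fun e => digit 0 1 p (choice.pickle e) x.

Lemma measurable_digit (a w : R) p' n :
  measurable [set x : measurableTypeR R | digit a w p' n x].
Proof.
have ml c : measurable [set x : measurableTypeR R | x < c].
  rewrite (_ : [set _ | _] = `]-oo, c[%classic); last first.
    by apply/seteqP; split=> x /=; rewrite in_itv.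
  exact: measurable_itv.
elim: n a w p' => [|n IHn] a w p' //=.
rewrite (_ : [set _ | _] =
    ([set x | x < a + p' 0%N * w] `&`
       [set x | digit a (p' 0%N * w) (p' \o S) n x]) `|`
    (~` [set x | x < a + p' 0%N * w] `&`
       [set x | digit (a + p' 0%N * w) ((1 - p' 0%N) * w) (p' \o S) n x])).
  apply: measurableU; apply: measurableI; rewrite //.
  exact/measurableC.
apply/seteqP; split=> x /=.
  by case: ifPn => xp; [left|right; split=> //; apply/negP].
by case=> -[]; [move=> -> | move=> /negP/negbTE ->].
Qed.

Let mX : measurable_fun setT X.
Proof.
apply: (@measurability _ _ _ _ setT X _ erefl) => _ [_ [e _ <-] <-].
rewrite setTI; exact: measurable_digit.
Qed.

Let X' : {mfun measurableTypeR R >-> config d} :=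
  HB.pack X (isMeasurableFun.Build _ _ _ _ X mX).

Let U01 := mrestr (@lebesgue_measure R) (measurable_itv `[0:R, 1[).

Let U01_setT : U01 setT = 1%E.
Proof.
by rewrite /U01 /mrestr setTI lebesgue_measure_itv/= lte_fin ltr01 -EFinB subr0.
Qed.

HB.instance Definition _ := Measure.on U01.
HB.instance Definition _ := Measure_isProbability.Build _ _ R U01 U01_setT.

Lemma product_law_exists : exists P : probability (config d) R,
  forall F : {fset edge d},
    P (\bigcap_(e in [set` F]) open_event e) = (\prod_(e <- F) q e)%:E.
Proof.
exists (distribution U01 X') => F.
set A := \bigcap_(e in _) _.
change (lebesgue_measure (X @^-1` A `&` `[0, 1[) = (\prod_(e <- F) q e)%:E).
pose n := (\max_(e <- F) choice.pickle e).+1.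
pose F' (i : nat) := has (fun e => choice.pickle e == i) F.
have pF e : e \in F -> (choice.pickle e < n)%N.
  by move=> eF; rewrite ltnS; apply: leq_bigmax_seq.
rewrite (_ : _ `&` _ = digit_set 0 1 p F' n); last first.
  apply/seteqP; split=> x /=; rewrite /digit_set/= in_itv/= add0r.
    by move=> [H x01]; split=> // i _ /hasP[e eF /eqP <-]; apply: (H e eF).
  move=> [x01 H]; split=> // e /= eF.
  by apply: H; [exact: pF | apply/hasP; exists e].
have [_ ->] := digit_setP 0 F' n p01 ler01.
congr EFin; rewrite mul1r -big_mkcond/=.
rewrite (eq_big_seq (fun e => p (choice.pickle e))); last first.
  by move=> e _; rewrite /p choice.pickleK.
rewrite -(big_map choice.pickle xpredT p) -(big_mkord F' p) -big_filter.
apply: perm_big; apply: uniq_perm.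
- by rewrite filter_uniq// iota_uniq.
- by rewrite map_inj_uniq ?fset_uniq//; exact: (pcan_inj choice.pickleK).
move=> i; rewrite mem_filter mem_index_iota /=; apply/andP/mapP.
  by move=> [/hasP[e eF /eqP <-] _]; exists e.
by move=> [e eF ->]; split; [apply/hasP; exists e | exact: pF].
Qed.

End percolation_law_existence.

Lemma kernelN (R : realType) (d : nat) (J : lattice d -> R) x :
  is_kernel J -> J (- x) = J x.
Proof.
move=> hJ; rewrite -(kernel_flip hJ xpredT x); congr J.
by apply/rowP => i; rewrite !mxE.
Qed.

Lemma percolation_lawP (R : realType) (d : nat) (beta : R) (J : lattice d -> R) :
  0 <= beta -> is_kernel J -> is_percolation_law beta J (percolation_law beta J).
Proof.
move=> b0 hJ.
pose q (e : edge d) : R := let s := enum_fset (val e) in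
  1 - expR (- (beta * J (s`_0 - s`_1))).
have q01 e : 0 <= q e <= 1.
  have := mulr_ge0 b0 (kernel_ge0 hJ ((enum_fset (val e))`_0 - (enum_fset (val e))`_1)).
  move=> H; rewrite /q subr_ge0 gerBl expR_ge0 andbT.
  by rewrite -expR0 ler_expR oppr_le0.
have [P HP] := product_law_exists q01.
have P1 e : P (open_event e) = (q e)%:E.
  have := HP [fset e]%fset; rewrite big_seq_fset1 => <-.
  by rewrite set_fset1 bigcap_set1.
suff : is_percolation_law beta J P.
  by move=> hP; apply: (@getPex _ [set P | is_percolation_law beta J P]); exists P.
split=> [e x y exy|F].
  rewrite P1; congr EFin; rewrite /q.
  have : enum_fset (val e) =i [:: x; y].
    by move=> z; rewrite -[LHS]/(z \in val e) exy !inE.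
  have := fset_uniq (val e); have : size (enum_fset (val e)) == 2%N := valP e.
  case: (enum_fset (val e)) => [|u [|v []]]//= _ /andP[+ _] uv.
  rewrite inE => nuv.
  have := uv u; have := uv v; rewrite !inE !eqxx orbT /=.
  move=> /esym/orP[] /eqP ev /esym/orP[] /eqP eu; subst.
  - by rewrite eqxx in nuv.
  - by rewrite -(kernelN _ hJ) opprB.
  - by [].
  - by rewrite eqxx in nuv.
transitivity (\prod_(e <- F) q e)%:E; first exact: HP.
by rewrite -prodEFin; apply: eq_bigr => e _; rewrite P1.
Qed.

Lemma countType_bigcup_measurable disp (T : measurableType disp) (U : countType)
    (D : set U) (F : U -> set T) :
  (forall i, D i -> measurable (F i)) -> measurable (\bigcup_(i in D) F i).
Proof.
move=> mF; rewrite bigcup_mkcond.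
apply: countable_bigcupT_measurable => // i.
by case: ifPn => // /set_mem; exact: mF.
Qed.

Lemma measurable_connected_in (d : nat) (x y : lattice d) :
  measurable [set w : config d | connected_in w x y].
Proof.
pose adj w u v := `[< exists2 e : edge d, is_edge e u v & w e >].
have mo (e : edge d) : measurable (open_event e : set (config d)).
  by apply: sub_sigma_algebra; exists e.
have ma u v : measurable [set w : config d | adj w u v].
  rewrite (_ : [set _ | _] = \bigcup_(e in [set e : edge d | is_edge e u v])
    (open_event e : set (config d))).
    by apply: countType_bigcup_measurable => e _; exact: mo.
  apply/seteqP; split=> w /=; first by move=> /asboolP[e ? ?]; exists e.
  by move=> [e ? ?]; apply/asboolP; exists e.
have mp s : measurable [set w : config d | path (adj w) x s].
  elim: s x => [|u s IHs] v.
    by rewrite (_ : [set _ | _] = setT)//; apply/seteqP; split.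
  rewrite (_ : [set _ | _] = [set w : config d | adj w v u] `&`
      [set w : config d | path (adj w) u s]); first exact: measurableI.
  by apply/seteqP; split=> w /=; [move/andP|move=> [? ?]; apply/andP].
rewrite (_ : [set _ | _] = \bigcup_(s in [set s | last x s = y])
    [set w : config d | path (adj w) x s]).
  by apply: countType_bigcup_measurable => s _; exact: mp.
by apply/seteqP; split=> w; [move=> [s [? ?]]; exists s|move=> [s ? ?]; exists s].
Qed.

Lemma measurable_infinite_cluster (d : nat) (x : lattice d) :
  measurable [set w : config d | infinite_set (open_cluster w x)].
Proof.
rewrite (_ : [set _ | _] = \bigcap_(F in [set: {fset lattice d}])
   \bigcup_(y in ~` [set` F]) [set w : config d | connected_in w x y]).
  rewrite -[X in measurable X]setCK setC_bigcap; apply: measurableC.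
  apply: countType_bigcup_measurable => F _; apply: measurableC.
  by apply: countType_bigcup_measurable => y _; exact: measurable_connected_in.
apply/seteqP; split=> w /=.
  move=> inf F _; apply: contrapT => H; apply: inf.
  apply: (@sub_finite_set _ _ [set` F]) => // y xy /=.
  by apply: contrapT => yF; apply: H; exists y.
move=> H /finite_fsetP[F eF].
by have [y + wy] := H F I; apply; rewrite -eF.
Qed.

Lemma is_edge_exists (d : nat) (e : edge d) : exists x y, is_edge e x y.
Proof.
have : size (enum_fset (val e)) == 2%N := valP e.
case E : (enum_fset (val e)) => [|x [|y []]]//= _; exists x, y.
by apply/fsetP => z; rewrite -[LHS]/(z \in enum_fset (val e)) E !inE.
Qed.

Lemma percolation_law_unique (R : realType) (d : nat) (beta : R)
    (J : lattice d -> R) (P Q : probability (config d) R) :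
  is_percolation_law beta J P -> is_percolation_law beta J Q ->
  forall A, measurable A -> P A = Q A.
Proof.
move=> [P1 PI] [Q1 QI].
have PQ1 e : P (open_event e) = Q (open_event e).
  by have [x [y exy]] := is_edge_exists e; rewrite (P1 _ _ _ exy) (Q1 _ _ _ exy).
have PQ (F : {fset edge d}) : P (\bigcap_(e in [set` F]) open_event e) =
            Q (\bigcap_(e in [set` F]) open_event e).
  transitivity (\prod_(e <- F) P (open_event e))%E; first exact: PI.
  by rewrite (eq_bigr _ (fun e _ => PQ1 e)); apply/esym; exact: QI.
pose cyl := [set \bigcap_(e in [set` F]) (open_event e : set (config d)) |
              F in [set: {fset edge d}]].
have cylT : cyl setT.
  by exists fset0%fset => //; rewrite set_fset0 bigcap_set0.
have mo (e : edge d) : measurable (open_event e : set (config d)).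
  by apply: sub_sigma_algebra; exists e.
apply: (@measure_unique _ R (config d) cyl (fun=> setT)) => //.
- apply/seteqP; split.
    apply: smallest_sub; first exact: smallest_sigma_algebra.
    move=> _ [e _ <-]; apply: sub_sigma_algebra; exists [fset e]%fset => //.
    by rewrite set_fset1 bigcap_set1.
  apply: smallest_sub; first exact: sigma_algebra_measurable.
  move=> _ [F _ <-]; apply: fin_bigcap_measurable => // e _; exact: mo.
- move=> _ _ [F _ <-] [G _ <-]; exists (F `|` G)%fset => //.
  by rewrite set_fsetU bigcap_setU.
- by apply/seteqP; split=> // w _; exists 0%N.
- by move=> _ [F _ <-]; exact: PQ.
- by move=> _; apply: (le_lt_trans (probability_le1 P measurableT)); exact: ltry.
Qed.

(* Main.v *)
Require Import Defs.
From mathcomp Require Import all_boot all_order all_algebra all_fingroup finmap.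
From mathcomp Require Import all_classical all_reals all_analysis.
From mathcomp Require Import ring lra zify.

(* The kernel J at inverse temperature beta is studied through perc a, the law
   under which every edge e is open with probability 1 - exp (- a e), so that
   the union of independent samples of perc a and perc b has law perc (a + b).

   Upper semicontinuity: "the cluster of 0 lies in a given finite set" only
   depends on the edges touching that set, hence its probability is continuous
   in (beta, J) for the L1 distance, and these events exhaust "the cluster of 0
   is finite".

   Lower semicontinuity above beta_c follows Haggstrom and Peres.  Choose
   beta_c < b' < beta and write the configuration at beta as w + h, with w
   sampled at b' and h at beta - b'.  By resilience and the zero-one law some
   vertex is rich: its cluster in w, restricted to edges of bounded length, is
   infinite.  Almost surely an infinite cluster of w + h meets the rich vertices.
   Otherwise inserting finitely many edges would produce, with positive
   probability, an infinite set of vertices linked to the rich ones through a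
   single gate; if all its vertices send unit mass to the gate, the gate receives
   infinite mass, against the mass transport principle.  Thus theta beta J is
   approximated by the probability that 0 is joined to a rich vertex by finitely
   many edges, where only edges of bounded length matter.  On these, J_n
   eventually dominates b' J / beta_n, so that this event has, up to a small
   error, at least the same probability for J_n. *)

Import Order.TTheory GRing.Theory Num.Theory.
Import numFieldNormedType.Exports.

Local Open Scope classical_set_scope.
Local Open Scope ring_scope.

Set Implicit Arguments.
Unset Strict Implicit.
Unset Printing Implicit Defensive.

(** * Laws of independent edges *)

Section bernoulli_law.
Context {R : realType} {d : nat}.
Implicit Types (a b : edge d -> R) (e : edge d) (s t : seq (edge d)).
Implicit Types (w h : config d) (A : set (config d)).

(** For nonnegative [a] such a law exists by [product_law_exists]; nothing is claimed for other
    weights. *)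
Definition perc a : probability (config d) R :=
  get [set P : probability (config d) R | forall F : {fset edge d},
    P (\bigcap_(e in [set` F]) open_event e) =
      (\prod_(e <- F) (1 - expR (- a e)))%:E].

(** These events form a pi-system generating the sigma-algebra, and their probabilities are
    exponentials of sums of weights, so identities between laws reduce to identities between
    sums. *)
Definition closed_on s : set (config d) := [set w : config d | ~~ has w s].

Lemma perc_open a (F : {fset edge d}) : (forall e, 0 <= a e) ->
  perc a (\bigcap_(e in [set` F]) open_event e) =
    (\prod_(e <- F) (1 - expR (- a e)))%:E.
Proof.
move=> a0.
have q01 e : 0 <= 1 - expR (- a e) <= 1.
  by rewrite subr_ge0 gerBl expR_ge0 andbT -expR0 ler_expR oppr_le0.
have [P HP] := product_law_exists q01.
exact: (@getPex _ [set P : probability (config d) R | forall F : {fset edge d},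
    P (\bigcap_(e in [set` F]) open_event e) =
      (\prod_(e <- F) (1 - expR (- a e)))%:E] (ex_intro _ P HP)).
Qed.

Lemma measurable_open_event e : measurable (open_event e : set (config d)).
Proof. by apply: sub_sigma_algebra; exists e. Qed.

Lemma measurable_closed_on s : measurable (closed_on s).
Proof.
elim: s => [|e s IH].
  by rewrite (_ : closed_on _ = setT)//; apply/seteqP; split.
rewrite (_ : closed_on _ = ~` (open_event e : set (config d)) `&` closed_on s).
  by apply: measurableI => //; apply: measurableC; exact: measurable_open_event.
apply/seteqP; split=> w; rewrite /closed_on /open_event /=.
  by rewrite negb_or => /andP[/negP ? ?].
by move=> [/negP ? ?]; rewrite negb_or; apply/andP.
Qed.

(** Induction on [s]: the case where its first edge [e] is closed is the difference between leaving
    [e] free and moving [e] to [t]. *)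
Lemma perc_open_closed a s t : (forall e, 0 <= a e) -> uniq (s ++ t) ->
  perc a [set w : config d | all w t && ~~ has w s] =
    (\prod_(e <- t) (1 - expR (- a e)) * \prod_(e <- s) expR (- a e))%:E.
Proof.
move=> a0; elim: s t => [|e s IH] t /=.
  move=> ut; rewrite big_nil mulr1.
  pose F := [fset e in t]%fset.
  rewrite (_ : [set _ | _] = \bigcap_(e in [set` F]) open_event e); last first.
    apply/seteqP; split=> w /=; rewrite andbT.
      by move=> /allP H e /=; rewrite /F inE => /H.
    by move=> H; apply/allP => e et; apply: H; rewrite /= /F inE.
  rewrite perc_open//; congr EFin; apply: perm_big; apply: uniq_perm => //.
  by move=> e; rewrite /F !inE.
move=> /andP[nest ust]; rewrite big_cons.
have m1 s' t' : measurable [set w : config d | all w t' && ~~ has w s'].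
  rewrite (_ : [set _ | _] = closed_on s' `&`
      \bigcap_(e in [set` [fset e in t']%fset]) (open_event e : set (config d))).
    apply: measurableI; first exact: measurable_closed_on.
    by apply: fin_bigcap_measurable => // ? _; exact: measurable_open_event.
  apply/seteqP; split=> w /=.
    by move=> /andP[/allP H Hs]; split=> // e' /=; rewrite inE => /H.
  move=> [Hs H]; apply/andP; split=> //; apply/allP => e' et; apply: H.
  by rewrite /= inE.
have E : [set w : config d | all w t && ~~ has w s] =
   [set w : config d | all w t && ~~ (w e || has w s)] `|`
   [set w : config d | w e && all w t && ~~ has w s].
  apply/seteqP; split=> w /=.
    by move=> /andP[-> ws]; case: (w e); [right|left]; rewrite /= ws.
  case; last by move=> /andP[/andP[_ ->] ->].
  by move=> /andP[->]; rewrite negb_or => /andP[_ ->].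
have := IH t; rewrite cat_uniq in ust; rewrite cat_uniq => /(_ ust).
rewrite E measureU//; first last.
- apply/seteqP; split=> // w [] /= /andP[_]; rewrite negb_or => /andP[H _].
  by rewrite (negbTE H).
- exact: (m1 s (e :: t)).
- exact: (m1 (e :: s) t).
have ust' : uniq (s ++ e :: t).
  rewrite cat_uniq/=; case/and3P: ust => -> H ->.
  move: nest; rewrite mem_cat negb_or => /andP[nes ->].
  by rewrite (negbTE nes)/= H.
rewrite [X in (_ + X)%E](IH (e :: t) ust') big_cons.
have aux (x : \bar R) (y z : R) : (x + y%:E)%E = z%:E -> x = (z - y)%:E.
  by case: x => [x||]// [<-]; rewrite addrK.
by move=> /aux ->; congr EFin; ring.
Qed.

Lemma perc_closed a s : (forall e, 0 <= a e) -> uniq s ->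
  perc a (closed_on s) = (expR (- \sum_(e <- s) a e))%:E.
Proof.
move=> a0 us; have := @perc_open_closed a s [::] a0.
rewrite cats0 => /(_ us) /=; rewrite big_nil mul1r => ->; congr EFin.
rewrite -sumrN; elim: s {us} => [|e s IH].
  by rewrite !big_nil expR0.
by rewrite !big_cons expRD IH.
Qed.

(** Pi-system argument. The lists are duplicate-free since a repeated edge would count its weight
    twice; the empty list gives [m] total mass 1. *)
Lemma perc_unique a (m : {measure set (config d) -> \bar R}) :
  (forall e, 0 <= a e) ->
  (forall s, uniq s -> m (closed_on s) = (expR (- \sum_(e <- s) a e))%:E) ->
  forall A, measurable A -> m A = perc a A.
Proof.
move=> a0 hm.
pose G := [set closed_on s | s in [set: seq (edge d)]].
have GT : G setT.
  by exists [::] => //; apply/seteqP; split.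
have clu s : closed_on (undup s) = closed_on s.
  apply/seteqP; split=> w; rewrite /closed_on /= => /hasPn H; apply/hasPn => e es.
    by apply: H; rewrite mem_undup.
  by apply: H; rewrite -mem_undup.
apply: (measure_unique G (fun=> setT)) => //.
- apply/seteqP; split.
    apply: smallest_sub; first exact: smallest_sigma_algebra.
    move=> _ [e _ <-]; rewrite -(setCK (open_event e)).
    apply: (@sigma_algebraC _ G).
    apply: sub_sigma_algebra; exists [:: e] => //.
    apply/seteqP; split=> w; rewrite /closed_on /open_event /= orbF.
      exact: negP.
    by move=> /negP.
  apply: smallest_sub; first exact: sigma_algebra_measurable.
  by move=> _ [s _ <-]; exact: measurable_closed_on.
- move=> _ _ [s _ <-] [t _ <-]; exists (s ++ t) => //.
  apply/seteqP; split=> w; rewrite /closed_on /= has_cat negb_or.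
    by move=> /andP.
  by move=> [-> ->].
- by apply/seteqP; split=> // w _; exists 0%N.
- move=> _ [s _ <-]; rewrite -clu.
  exact: etrans (hm _ (undup_uniq s)) (esym (perc_closed a0 (undup_uniq s))).
- move=> _; have := hm [::]; rewrite /= big_nil => /(_ erefl).
  have -> : closed_on [::] = setT by apply/seteqP; split.
  by move=> ->; exact: ltry.
Qed.

End bernoulli_law.

Section image_measure.
Context d d' (T : measurableType d) (T' : measurableType d') (R : realType).
Variables (m : {measure set T -> \bar R}) (f : T -> T') (mf : measurable_fun setT f).
Definition image_measure : {measure set T' -> \bar R} :=
  measure_function_pushforward__canonical__measure_function_Measure m mf.
Lemma image_measureE A : image_measure A = m (f @^-1` A).
Proof. by []. Qed.
End image_measure.

Lemma measurable_preimage d d' (T : measurableType d) (T' : measurableType d')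
    (f : T -> T') (A : set T') :
  measurable_fun setT f -> measurable A -> measurable (f @^-1` A).
Proof. by move=> mf mA; rewrite -[X in measurable X]setTI; exact: mf. Qed.

(** * Fubini comparisons for product laws *)

Section product_law.
Context d1 d2 d1' d2' (T1 : measurableType d1) (T2 : measurableType d2)
  (T1' : measurableType d1') (T2' : measurableType d2') (R : realType).
Local Open Scope ereal_scope.

Lemma product_law_image (P1 : probability T1 R) (P2 : probability T2 R)
    (Q1 : probability T1' R) (Q2 : probability T2' R)
    (f1 : T1 -> T1') (f2 : T2 -> T2') :
  measurable_fun setT f1 -> measurable_fun setT f2 ->
  (forall A, measurable A -> P1 (f1 @^-1` A) = Q1 A) ->
  (forall A, measurable A -> P2 (f2 @^-1` A) = Q2 A) ->
  forall A, measurable A ->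
    (P1 \x P2) [set z | A (f1 z.1, f2 z.2)] = (Q1 \x Q2) A.
Proof.
move=> mf1 mf2 h1 h2 A mA.
have mf : measurable_fun setT (fun z : T1 * T2 => (f1 z.1, f2 z.2)).
  by apply: measurable_fun_pair; exact: measurableT_comp.
rewrite (@product_measure_unique _ _ _ _ _ Q1 Q2
  (image_measure (P1 \x P2) mf))// => B C mB mC.
transitivity ((P1 \x P2) ((f1 @^-1` B) `*` (f2 @^-1` C))); first by [].
rewrite product_measure1E; try exact: measurable_preimage.
by rewrite [X in X * _]h1// [X in _ * X]h2.
Qed.

Lemma le_product_section2 (P1 : probability T1 R) (P2 : probability T2 R) (c : R)
    (A B : set (T1 * T2)) : (0 <= c)%R -> measurable A -> measurable B ->
  (forall x, c%:E * P2 (xsection A x) <= P2 (xsection B x)) ->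
  c%:E * (P1 \x P2) A <= (P1 \x P2) B.
Proof.
move=> c0 mA mB h.
rewrite /product_measure1 -ge0_integralZl//; first last.
  exact: measurable_fun_xsection.
apply: ge0_le_integral => //.
- by move=> x _; rewrite mule_ge0.
- by apply: measurable_funeM; exact: measurable_fun_xsection.
- exact: measurable_fun_xsection.
- by move=> x _; exact: h.
Qed.

Lemma product_measure12 (P1 : probability T1 R) (P2 : probability T2 R)
    (A : set (T1 * T2)) : measurable A -> (P1 \x P2) A = (P1 \x^ P2) A.
Proof.
move=> mA; apply: product_measure_unique => // B C mB mC.
exact: product_measure2E.
Qed.

Lemma le_product_section1 (P1 : probability T1 R) (P2 : probability T2 R) (c : R)
    (A B : set (T1 * T2)) : (0 <= c)%R -> measurable A -> measurable B ->
  (forall y, c%:E * P1 (ysection A y) <= P1 (ysection B y)) ->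
  c%:E * (P1 \x P2) A <= (P1 \x P2) B.
Proof.
move=> c0 mA mB h; rewrite !product_measure12//.
rewrite /product_measure2 -ge0_integralZl//; first last.
  exact: measurable_fun_ysection.
apply: ge0_le_integral => //.
- by move=> x _; rewrite mule_ge0.
- by apply: measurable_funeM; exact: measurable_fun_ysection.
- exact: measurable_fun_ysection.
- by move=> y _; exact: h.
Qed.

End product_law.

(** * Unions, restrictions and resampling of configurations *)

Section config_maps.
Context {R : realType} {d : nat}.
Implicit Types (a b : edge d -> R) (e : edge d) (s t : seq (edge d)).
Implicit Types (w h : config d) (A B : set (config d)) (T : pred (edge d)).

Definition union_config w h : config d := fun e => w e || h e.

Definition restrict T w : config d := fun e => T e && w e.

Definition set_open e w : config d := fun e' => (e' == e) || w e'.

Definition restrict_weight T a : edge d -> R := fun e => if T e then a e else 0.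

Lemma measurable_config_fun d' (X : measurableType d') (f : X -> config d) :
  (forall e, measurable [set x | f x e]) -> measurable_fun setT f.
Proof.
move=> mf; apply: (@measurability _ _ _ _ setT f _ erefl) => _ [_ [e _ <-] <-].
by rewrite setTI; exact: mf.
Qed.

Lemma measurable_restrict T : measurable_fun setT (restrict T).
Proof.
apply: measurable_config_fun => e; rewrite /restrict.
case: (T e) => /=; last by rewrite (_ : [set _ | _] = set0)//; apply/seteqP; split.
exact: measurable_open_event.
Qed.

Lemma measurable_union_config :
  measurable_fun setT (fun z : config d * config d => union_config z.1 z.2).
Proof.
apply: measurable_config_fun => e.
rewrite (_ : [set _ | _] = (open_event e : set (config d)) `*` setT `|`
   setT `*` (open_event e : set (config d))).
  by apply: measurableU; apply: measurableX => //; exact: measurable_open_event.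
apply/seteqP; split=> -[w h]; rewrite /union_config /open_event /=.
  by move=> /orP[]; [left|right].
by case=> -[? ?]; apply/orP; [left|right].
Qed.

Lemma perc_restrict a T A : (forall e, 0 <= a e) -> measurable A ->
  perc a (restrict T @^-1` A) = perc (restrict_weight T a) A.
Proof.
move=> a0; rewrite -(image_measureE _ (measurable_restrict T)).
apply: perc_unique => [e|s us]; first by rewrite /restrict_weight; case: ifP.
rewrite image_measureE (_ : _ @^-1` _ = closed_on [seq e <- s | T e]).
  by rewrite [LHS](perc_closed a0 (filter_uniq T us)) big_filter big_mkcond.
apply/seteqP; split=> w; rewrite /closed_on /= => /hasPn H; apply/hasPn => e.
  by rewrite mem_filter => /andP[Te es]; have := H _ es; rewrite /restrict Te.
by move=> es; rewrite /restrict; case Te: (T e) => //=; apply: H;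
  rewrite mem_filter Te.
Qed.

Lemma perc_union a b A : (forall e, 0 <= a e) -> (forall e, 0 <= b e) ->
  measurable A ->
  (perc a \x perc b)%E [set z | A (union_config z.1 z.2)] =
  perc (fun e => a e + b e) A.
Proof.
move=> a0 b0; rewrite -(image_measureE _ measurable_union_config).
apply: perc_unique => [e|s us]; first by rewrite addr_ge0.
rewrite image_measureE (_ : _ @^-1` _ = closed_on s `*` closed_on s).
  transitivity (perc a (closed_on s) * perc b (closed_on s))%E.
    by apply: product_measure1E; exact: measurable_closed_on.
  rewrite [X in (X * _)%E](perc_closed a0 us) [X in (_ * X)%E](perc_closed b0 us).
  by rewrite -EFinM -expRD -opprD -big_split.
apply/seteqP; split=> -[w h]; rewrite /closed_on /union_config /=.
  by move=> /hasPn H; split; apply/hasPn => e /H; rewrite negb_or => /andP[].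
move=> [/hasPn H1 /hasPn H2]; apply/hasPn => e es.
by rewrite negb_or H1// H2.
Qed.

(** Resampling the edges of [T] independently of the others preserves the law: the restrictions to
    [T] and to its complement have weights that add up to [a]. *)
Lemma perc_splice a T A : (forall e, 0 <= a e) -> measurable A ->
  (perc a \x perc a)%E
    [set z | A (union_config (restrict (predC T) z.1) (restrict T z.2))] =
  perc a A.
Proof.
move=> a0 mA.
have r0 S e : 0 <= restrict_weight S a e by rewrite /restrict_weight; case: ifP.
transitivity ((perc (restrict_weight (predC T) a) \x
    perc (restrict_weight T a))%E [set z | A (union_config z.1 z.2)]).
  apply: (@product_law_image _ _ _ _ _ _ _ _ _ _ _ _ _ (restrict (predC T))
    (restrict T) _ _ _ _ [set z | A (union_config z.1 z.2)]) => [||B mB|B mB|].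
  - exact: measurable_restrict.
  - exact: measurable_restrict.
  - exact: perc_restrict.
  - exact: perc_restrict.
  - exact: measurable_preimage measurable_union_config mA.
rewrite perc_union//; congr (perc _ _); apply/funext => e.
by rewrite /restrict_weight /=; case: (T e); rewrite ?addr0 ?add0r.
Qed.

Lemma perc_open1 a e : (forall e, 0 <= a e) ->
  perc a (open_event e) = (1 - expR (- a e))%:E.
Proof.
move=> a0; have := @perc_open _ _ a [fset e]%fset a0.
by rewrite set_fset1 bigcap_set1 big_seq_fset1.
Qed.

(** Finite energy: resample [e] alone. When the first sample lies in [A] and the second has [e]
    open, the spliced configuration is the first one with [e] opened, hence in [B]. *)
Lemma insert_open a e A B : (forall e, 0 <= a e) ->
  measurable A -> measurable B -> (forall w, A w -> B (set_open e w)) ->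
  ((1 - expR (- a e))%:E * perc a A <= perc a B)%E.
Proof.
move=> a0 mA mB AB.
rewrite -[leRHS](perc_splice (pred1 e) a0 mB) muleC -perc_open1//.
rewrite -product_measure1E//; last exact: measurable_open_event.
apply: le_measure; rewrite ?inE.
- by apply: measurableX => //; exact: measurable_open_event.
- pose f (z : config d * config d) := (restrict (predC (pred1 e)) z.1, restrict (pred1 e) z.2).
  have mf : measurable_fun setT f.
    by apply: measurable_fun_pair; apply: measurableT_comp => //;
      exact: measurable_restrict.
  exact: measurable_preimage mf (measurable_preimage measurable_union_config mB).
move=> [w h] /= [wA he]; rewrite (_ : union_config _ _ = set_open e w); first exact: AB.
apply/funext => e'; rewrite /union_config /restrict /set_open /=.
by case: eqP => [->|]//=; rewrite ?orbF// he.
Qed.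

End config_maps.

(** * Mass transport *)

Section countable_families.
Context d (T : measurableType d) (R : realType) (U : countType).
Variable mu : {measure set T -> \bar R}.
Implicit Types E : U -> set T.
Local Open Scope ereal_scope.

Let seq_of E (n : nat) : set T :=
  if @choice.pickle_inv U n is Some u then E u else set0.

Let bigcup_seq_of E : \bigcup_n seq_of E n = \bigcup_u E u.
Proof.
apply/seteqP; split=> t.
  by move=> [n _]; rewrite /seq_of; case: choice.pickle_inv => // u; exists u.
by move=> [u _ Eut]; exists (choice.pickle u) => //; rewrite /seq_of choice.pickleK_inv.
Qed.

Let measurable_seq_of E : (forall u, measurable (E u)) ->
  forall n, measurable (seq_of E n).
Proof. by move=> mE n; rewrite /seq_of; case: choice.pickle_inv. Qed.

Let nneseries_seq_of E : (forall u, measurable (E u)) ->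
  \sum_(n <oo) mu (seq_of E n) = \esum_(u in setT) mu (E u).
Proof.
move=> mE; rewrite nneseries_esumT; last by move=> n; exact: measure_ge0.
rewrite (_ : \esum_(u in setT) _ =
    \esum_(n in @choice.pickle U @` setT) mu (seq_of E n)); last first.
  rewrite esum_image; last by move=> u v _ _; exact: (pcan_inj choice.pickleK).
  by apply: eq_esum => u _; rewrite /seq_of choice.pickleK_inv.
rewrite [RHS]esum_mkcond; apply: eq_esum => n _; case: ifPn => // nU.
rewrite /seq_of; case E' : (choice.pickle_inv _) => [u|]//.
have := @choice.pickle_invK U n; rewrite E' /= => nu.
by move: nU; rewrite -nu => /negP[]; rewrite inE; exists u.
Qed.

Lemma measure_countable_subadditive E : (forall u, measurable (E u)) ->
  mu (\bigcup_u E u) <= \esum_(u in setT) mu (E u).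
Proof.
move=> mE; rewrite -nneseries_seq_of// -bigcup_seq_of.
apply: generalized_Boole_inequality; first exact: measurable_seq_of.
by apply: bigcup_measurable => n _; exact: measurable_seq_of.
Qed.

Lemma measure_countable_null E : (forall u, measurable (E u)) ->
  (forall u, mu (E u) = 0) -> mu (\bigcup_u E u) = 0.
Proof.
move=> mE E0; apply/eqP; rewrite eq_le measure_ge0 andbT.
apply: (le_trans (measure_countable_subadditive mE)).
by rewrite esum1// => u _; rewrite E0.
Qed.

Lemma esum_disjoint E : (forall u, measurable (E u)) ->
  (forall u v, u <> v -> E u `&` E v = set0) ->
  \esum_(u in setT) mu (E u) = mu (\bigcup_u E u).
Proof.
move=> mE dE; rewrite -nneseries_seq_of// -bigcup_seq_of measure_bigcup//.
  by apply: eq_eseriesl => n; rewrite in_setT.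
  by move=> n _; exact: measurable_seq_of.
apply/trivIsetP => m n _ _; rewrite /seq_of.
case Em : (choice.pickle_inv m) => [u|]; last by rewrite set0I.
case En : (choice.pickle_inv n) => [v|]; last by rewrite setI0.
move=> /eqP mn; apply: dE => uv; apply: mn.
have := @choice.pickle_invK U m; have := @choice.pickle_invK U n.
by rewrite Em En /= uv => <- <-.
Qed.

(** First Borel-Cantelli lemma for [seq_of]: infinitely many indices cannot all have codes below a
    given [n]. *)
Lemma borel_cantelli_countable E A : (forall u, measurable (E u)) ->
  \esum_(u in setT) mu (E u) < +oo -> measurable A ->
  (forall t, A t -> infinite_set [set u | E u t]) -> mu A = 0.
Proof.
move=> mE fE mA infA; apply/eqP; rewrite eq_le measure_ge0 andbT.
rewrite -nneseries_seq_of// in fE.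
rewrite -(lim_sup_set_cvg0 (measurable_seq_of mE) fE).
apply: le_measure; rewrite ?inE//.
  by apply: bigcap_measurable => // n _; apply: bigcup_measurable => k _;
    exact: measurable_seq_of.
move=> t /infA infu n _; apply: contrapT => H; apply: infu.
apply: (@sub_finite_set _ _ ((@choice.pickle U) @^-1` `I_n)).
  move=> u Eut /=; rewrite ltnNge; apply/negP => nu; apply: H.
  by exists (choice.pickle u) => //; rewrite /seq_of choice.pickleK_inv.
apply: finite_preimage; last exact: finite_II.
by move=> u v _ _; exact: (pcan_inj choice.pickleK).
Qed.

End countable_families.

(* Here [D x y] is the event that [x] sends unit mass to [y]. *)
Lemma mass_transport disp (T : measurableType disp) (R : realType)
    (P : probability T R) (V : countZmodType) (D : V -> V -> set T) :
  (forall x y, measurable (D x y)) ->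
  (forall x y y', y <> y' -> D x y `&` D x y' = set0) ->
  (forall x y z, P (D (x + z) (y + z)) = P (D x y)) ->
  (forall x y t, D x y t -> infinite_set [set x' | D x' y t]) ->
  forall x y, P (D x y) = 0%E.
Proof.
move=> mD disjD DE infD x y.
apply: (@borel_cantelli_countable _ _ _ V P (D ^~ y)) => //; last first.
  by move=> t /infD.
(* Translating by [z - y] carries [D (y + y - z) y] to [D y z], so the expected mass received by [y]
   equals the expected mass sent by [y], which is at most 1. *)
rewrite (_ : \esum_(u in _) _ = \esum_(z in [set: V]) P (D y z))%E; last first.
  rewrite (reindex_esum setT setT (fun z => y + y - z) (fun u => P (D u y))).
    apply: eq_esum => z _; rewrite -(DE (y + y - z) y (z - y)); congr (P (D _ _)).
      by rewrite addrA subrK addrK.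
    by rewrite addrC subrK.
  split=> // [u v _ _ /addrI/oppr_inj//|z _].
  by exists (y + y - z) => //; rewrite opprB addrC subrK.
rewrite esum_disjoint//; last exact: disjD.
apply: (le_lt_trans (probability_le1 P _)); last exact: ltry.
exact: countType_bigcup_measurable.
Qed.

(** * Clusters *)

Section edges.
Context {d : nat}.
Implicit Types (e : edge d) (x y z u v : lattice d) (w h : config d).

Lemma is_edge_sym e x y : is_edge e x y -> is_edge e y x.
Proof. by rewrite /is_edge => ->; rewrite fsetUC. Qed.

Lemma is_edge_neq e x y : is_edge e x y -> x <> y.
Proof.
move=> exy xy; have := valP e; rewrite exy xy fsetUid.
by rewrite cardfs1.
Qed.

Lemma is_edge_inj e e' x y : is_edge e x y -> is_edge e' x y -> e = e'.
Proof. by move=> exy e'xy; apply: val_inj; rewrite /= exy e'xy. Qed.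

Lemma edge_exists x y : x <> y -> exists e, is_edge e x y.
Proof.
move=> /eqP xy; have H : #|` [fset x; y]%fset| == 2%N.
  by rewrite cardfs2 xy.
by exists (exist (fun e : {fset lattice d} => #|` e| == 2%N) [fset x; y]%fset H).
Qed.

Lemma is_edge_pair e x y u v : is_edge e x y -> is_edge e u v ->
  (u = x /\ v = y) \/ (u = y /\ v = x).
Proof.
move=> exy euv; have uv := is_edge_neq euv.
have : u \in val e by rewrite euv !inE eqxx.
have : v \in val e by rewrite euv !inE eqxx orbT.
rewrite exy !inE => /orP[]/eqP vE /orP[]/eqP uE; subst => //; first [by left|by right].
Qed.

Definition adjacent w x y : Prop := exists2 e, is_edge e x y & w e.

Lemma adjacent_sym w x y : adjacent w x y -> adjacent w y x.
Proof. by move=> [e /is_edge_sym ? ?]; exists e. Qed.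

Lemma connected_refl w x : connected_in w x x.
Proof. by exists [::]. Qed.

Lemma connected_step w x y z :
  connected_in w x y -> adjacent w y z -> connected_in w x z.
Proof.
move=> [s [ps ls]] yz; exists (rcons s z); rewrite rcons_path last_rcons ps ls.
by split=> //; apply/andP; split=> //; apply/asboolP.
Qed.

Lemma connected_ind w x (S : set (lattice d)) :
  S x -> (forall u v, connected_in w x u -> S u -> adjacent w u v -> S v) ->
  forall y, connected_in w x y -> S y.
Proof.
move=> Sx HS y [s [ps <-]]; elim/last_ind: s ps => [//|s z IH].
rewrite rcons_path last_rcons => /andP[ps /asboolP sz].
by apply: HS (IH ps) sz; exists s.
Qed.

Lemma connected_trans w x y z :
  connected_in w x y -> connected_in w y z -> connected_in w x z.
Proof.
move=> xy; move: z; apply: (connected_ind (S := connected_in w x)) => //.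
move=> u v _ xu uv; exact: connected_step xu uv.
Qed.

Lemma connected_adjacent w x y : adjacent w x y -> connected_in w x y.
Proof. exact/connected_step/connected_refl. Qed.

Lemma connected_sym w x y : connected_in w x y -> connected_in w y x.
Proof.
move: y; apply: (connected_ind (S := fun y => connected_in w y x)).
  exact: connected_refl.
move=> u v _ ux uv; apply: connected_trans ux.
exact/connected_adjacent/adjacent_sym.
Qed.

Lemma connected_mono w h x y : (forall e, w e -> h e) ->
  connected_in w x y -> connected_in h x y.
Proof.
move=> wh; move: y; apply: (connected_ind (S := connected_in h x)).
  exact: connected_refl.
move=> u v _ xu [e euv we]; apply: connected_step xu _.
by exists e => //; exact: wh.
Qed.

Lemma open_cluster_mono w h x : (forall e, w e -> h e) ->
  open_cluster w x `<=` open_cluster h x.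
Proof. by move=> wh y; exact: connected_mono. Qed.

Definition percolates x : set (config d) :=
  [set w : config d | infinite_set (open_cluster w x)].

Lemma percolates_mono w h x : (forall e, w e -> h e) ->
  percolates x w -> percolates x h.
Proof. move=> wh + fh; apply; exact: sub_finite_set (open_cluster_mono wh) fh. Qed.

Lemma percolates_connected w x y : connected_in w x y ->
  percolates x w -> percolates y w.
Proof.
move=> xy + fy; apply; apply: sub_finite_set fy => z; rewrite /open_cluster /=.
exact/connected_trans/connected_sym.
Qed.

Lemma shift_edge_subproof z e : #|` [fset (x + z)%R | x in val e]%fset| == 2%N.
Proof. by rewrite card_imfset ?(valP e)//; exact: addIr. Qed.

Definition shift_edge z e : edge d :=
  exist (fun e : {fset lattice d} => #|` e| == 2%N) _ (shift_edge_subproof z e).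

Lemma is_edge_shift z e x y : is_edge e x y -> is_edge (shift_edge z e) (x + z) (y + z).
Proof. by rewrite /is_edge /= => ->; rewrite imfsetU !imfset_fset1. Qed.

Lemma shift_edgeK z : cancel (shift_edge z) (shift_edge (- z)).
Proof.
move=> e; have [x [y exy]] := is_edge_exists e.
have := is_edge_shift (- z) (is_edge_shift z exy); rewrite !addrK => H.
exact: is_edge_inj H exy.
Qed.

(** The cluster of [x] in the new configuration is that of [x + z] in [w], translated by [- z]. *)
Definition shift_config z w : config d := fun e => w (shift_edge z e).

Lemma adjacent_shift z w x y :
  adjacent (shift_config z w) x y <-> adjacent w (x + z) (y + z).
Proof.
split=> [[e exy we]|[e exy we]].
  by exists (shift_edge z e) => //; exact: is_edge_shift.
have := is_edge_shift (- z) exy; rewrite !addrK => exy'.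
exists (shift_edge (- z) e) => //.
by rewrite /shift_config -{1}(opprK z) shift_edgeK.
Qed.

Lemma connected_shift z w x y :
  connected_in (shift_config z w) x y <-> connected_in w (x + z) (y + z).
Proof.
split.
  move: y; apply: (connected_ind (S := fun y => connected_in w (x + z) (y + z))).
    exact: connected_refl.
  by move=> u v _ xu /adjacent_shift; exact: connected_step.
rewrite -{2}(addrK z y); move: (y + z).
apply: (connected_ind (S := fun y' => connected_in (shift_config z w) x (y' - z))).
  by rewrite addrK; exact: connected_refl.
move=> u v _ xu uv; apply: connected_step xu _; apply/adjacent_shift.
by rewrite !subrK.
Qed.

Lemma infinite_preimage_shift z (S : set (lattice d)) :
  infinite_set [set y | S (y + z)] <-> infinite_set S.
Proof.
split=> infS finS; apply: infS.
  apply: (finite_preimage (f := fun y => y + z)) finS.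
  by move=> u v _ _ /addIr.
have := finite_image (fun y => y + z) finS; apply: sub_finite_set => y Sy.
by exists (y - z); rewrite /= subrK.
Qed.

Lemma percolates_shift z w x :
  percolates x (shift_config z w) <-> percolates (x + z) w.
Proof.
rewrite /percolates /= -(infinite_preimage_shift z (open_cluster w (x + z))).
rewrite (_ : open_cluster (shift_config z w) x = [set y | open_cluster w (x + z) (y + z)])//.
by apply/seteqP; split=> y; rewrite /open_cluster /=; apply connected_shift.
Qed.

Lemma measurable_shift_config z : measurable_fun setT (shift_config z).
Proof.
by apply: measurable_config_fun => e; exact: measurable_open_event.
Qed.

Lemma perc_shift (R : realType) (a : edge d -> R) z A : (forall e, 0 <= a e) ->
  (forall e, a (shift_edge z e) = a e) -> measurable A ->
  perc a (shift_config z @^-1` A) = perc a A.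
Proof.
move=> a0 az; rewrite -(image_measureE _ (measurable_shift_config z)).
apply: perc_unique => // s us.
rewrite image_measureE (_ : _ @^-1` _ = closed_on (map (shift_edge z) s)).
  rewrite [LHS](perc_closed a0); last by rewrite map_inj_uniq//; exact: can_inj (shift_edgeK z).
  by rewrite big_map; congr (expR (- _))%:E; apply: eq_bigr => e _; exact: az.
by apply/seteqP; split=> w; rewrite /closed_on /= has_map.
Qed.

(** Meaningful only up to sign, as the order in which the two endpoints are enumerated is arbitrary;
    it enters through even functions. *)
Definition edge_disp e : lattice d := (enum_fset (val e))`_0 - (enum_fset (val e))`_1.

Lemma edge_dispP e x y : is_edge e x y -> edge_disp e = x - y \/ edge_disp e = y - x.
Proof.
move=> exy; suff : is_edge e (enum_fset (val e))`_0 (enum_fset (val e))`_1.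
  by move=> /(is_edge_pair exy)[] [u v]; rewrite /edge_disp u v; [left|right].
have : size (enum_fset (val e)) == 2%N := valP e.
case E : (enum_fset (val e)) => [|u [|v []]]//= _.
by apply/fsetP => z; rewrite -[LHS]/(z \in enum_fset (val e)) E !inE.
Qed.

Lemma edge_disp_even T (f : lattice d -> T) e x y : (forall x, f (- x) = f x) ->
  is_edge e x y -> f (edge_disp e) = f (x - y).
Proof. by move=> fN /edge_dispP[] -> //; rewrite -opprB fN. Qed.

Lemma edge_disp_shift T (f : lattice d -> T) z e : (forall x, f (- x) = f x) ->
  f (edge_disp (shift_edge z e)) = f (edge_disp e).
Proof.
move=> fN; have [x [y exy]] := is_edge_exists e.
rewrite (edge_disp_even fN exy) (edge_disp_even fN (is_edge_shift z exy)).
by rewrite opprD addrACA subrr addr0.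
Qed.

Lemma enormN (R : realType) x : enorm R (- x) = enorm R x.
Proof.
by congr Num.sqrt; apply: eq_bigr => i _; rewrite mxE rmorphN sqrrN.
Qed.

End edges.

(** The law [perc] with these weights satisfies [is_percolation_law], whose solution is unique on
    measurable events. *)
Lemma theta_perc (R : realType) (d : nat) (beta : R) (J : lattice d -> R) :
  0 <= beta -> (forall x, 0 <= J x) -> (forall x, J (- x) = J x) ->
  (theta beta J)%:E = perc (fun e => beta * J (edge_disp e)) (percolates 0).
Proof.
move=> b0 J0 JN; set a : edge d -> R := fun e => beta * J (edge_disp e).
have a0 e : 0 <= a e by rewrite mulr_ge0.
have lawa : is_percolation_law beta J (perc a).
  split=> [e x y exy|F].
    by rewrite perc_open1// /a (edge_disp_even JN exy).
  rewrite perc_open// -prodEFin; apply: eq_bigr => e _.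
  by rewrite perc_open1.
have law : is_percolation_law beta J (percolation_law beta J).
  exact: (@getPex _ [set P | is_percolation_law beta J P] (ex_intro _ _ lawa)).
have mI := measurable_infinite_cluster (0 : lattice d).
rewrite /theta (percolation_law_unique law lawa mI) fineK//.
exact: fin_num_measure.
Qed.

(** * Zero-one law and comparison of laws *)

Section scaled_restriction.
Context disp (T : measurableType disp) (R : realType) (D : set T).
Variables (m : {measure set T -> \bar R}) (mD : measurable D) (r : {nonneg R}).

(** With [r] the inverse of the mass of [D], this is [m] conditioned on [D]. *)
Definition scaled_restriction : {measure set T -> \bar R} :=
  measure_function_mscale__canonical__measure_function_Measure r
    (measure_function_mrestr__canonical__measure_function_Measure m mD).

End scaled_restriction.

Section zero_one.
Context {R : realType} {d : nat}.
Implicit Types (a b c : edge d -> R) (w h : config d) (A : set (config d)).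
Implicit Types (T : pred (edge d)) (s : seq (edge d)).

Lemma measurable_percolates (x : lattice d) : measurable (percolates x).
Proof. exact: measurable_infinite_cluster. Qed.

(** Unlike percolation from a fixed vertex, this event is insensitive to the state of finitely many
    edges. *)
Definition supercritical : set (config d) := \bigcup_x percolates x.

Lemma measurable_supercritical : measurable supercritical.
Proof. by apply: countType_bigcup_measurable => x _; exact: measurable_percolates. Qed.

(** If all clusters of [h] were finite, an infinite cluster of [w] would be covered by finitely many
    of them: those of [x] and of the endpoints of the edges in [s]. *)
Lemma supercritical_finite_change s w h :
  (forall e, e \notin s -> w e = h e) -> supercritical w -> supercritical h.
Proof.
move=> wh [x _ infx]; apply: contrapT => H.
pose V := flatten [seq enum_fset (val e) | e <- s].
have finh y : finite_set (open_cluster h y).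
  by apply: contrapT => infy; apply: H; exists y.
apply: infx; apply: (@sub_finite_set _ _
  (open_cluster h x `|` \bigcup_(v in [set` V]) open_cluster h v)); last first.
  by rewrite finite_setU; split=> //; apply: bigcup_finite => //; exact: finite_seq.
apply: (connected_ind (S := open_cluster h x `|` \bigcup_(v in [set` V]) open_cluster h v)).
  by left; exact: connected_refl.
move=> u v _ Su [e euv we]; have [es|es] := boolP (e \in s).
  right; exists v; last exact: connected_refl.
  apply/flattenP; exists (enum_fset (val e)).
    exact: (@seq.map_f _ _ (fun e : edge d => enum_fset (val e)) s e es).
  by rewrite -[_ \in _]/(v \in val e) euv !inE eqxx orbT.
have uv : adjacent h u v by exists e => //; rewrite -wh.
case: Su => [xu|[y yV yu]]; first by left; exact: connected_step xu uv.
by right; exists y => //; exact: connected_step yu uv.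
Qed.

(** After resampling the edges of [s], [supercritical] depends on the first sample only and
    [closed_on s] on the second only. *)
Lemma perc_supercritical_closed a s : (forall e, 0 <= a e) ->
  perc a (supercritical `&` closed_on s) =
  (perc a supercritical * perc a (closed_on s))%E.
Proof.
move=> a0; have mS := measurable_supercritical.
have mc := measurable_closed_on s.
pose T : pred (edge d) := fun e => e \in s.
rewrite -[LHS](perc_splice T a0 (measurableI _ _ mS mc)).
rewrite -product_measure1E//; congr ((perc a \x perc a)%E _).
apply/seteqP; split=> -[w h] /= [H1 H2]; split.
- apply: (@supercritical_finite_change s _ _ _ H1) => e es.
  by rewrite /union_config /restrict /= /T (negbTE es) orbF.
- apply/hasPn => e es; have /hasPn/(_ _ es) := H2.
  by rewrite /union_config /restrict /= /T es.
- apply: (@supercritical_finite_change s _ _ _ H1) => e es.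
  by rewrite /union_config /restrict /= /T (negbTE es) orbF.
- apply/hasPn => e es; have /hasPn/(_ _ es) := H2.
  by rewrite /union_config /restrict /= /T es.
Qed.

(* [supercritical] is a tail event, hence independent of itself. *)
Lemma supercritical_zero_one a : (forall e, 0 <= a e) ->
  (0 < perc a supercritical)%E -> perc a supercritical = 1%E.
Proof.
move=> a0 pos; have mS := measurable_supercritical.
have pE : perc a supercritical = (fine (perc a supercritical))%:E.
  by rewrite fineK// fin_num_measure.
set p := fine _ in pE; have p0 : 0 < p by rewrite -lte_fin -pE.
have r0 : 0 <= p^-1 by rewrite invr_ge0 ltW.
(* The law conditioned on [supercritical] gives every [closed_on s] its former probability, so it is
   [perc a] itself; and it gives [supercritical] probability 1. *)
pose m := scaled_restriction (perc a) mS (NngNum r0).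
have mE A : m A = (p^-1%:E * perc a (A `&` supercritical))%E by [].
have -> : perc a supercritical = m supercritical.
  apply/esym; apply: perc_unique => // s us.
  rewrite mE setIC perc_supercritical_closed// pE muleA -EFinM mulVf ?gt_eqF//.
  by rewrite mul1e; exact: perc_closed.
by rewrite mE setIid pE -EFinM mulVf// gt_eqF.
Qed.

End zero_one.

Section comparison.
Context {R : realType} {d : nat}.
Implicit Types (a b c : edge d -> R) (w h : config d) (A : set (config d)).
Implicit Types (T : pred (edge d)) (f : lattice d -> R).

Definition some_open : set (config d) := [set w : config d | exists e, w e].

Lemma measurable_some_open : measurable some_open.
Proof.
rewrite (_ : some_open = \bigcup_e (open_event e : set (config d))).
  by apply: countType_bigcup_measurable => e _; exact: measurable_open_event.
by apply/seteqP; split=> w [e]; exists e.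
Qed.

Lemma not_some_open w h : ~ some_open h -> union_config w h = w.
Proof.
move=> H; apply/funext => e; rewrite /union_config.
by case E : (h e); rewrite ?orbF//; case: H; exists e.
Qed.

(** Coupling: [b] is sampled as the union of [a] and an independent sample of weights [b - a]; the
    two configurations differ only if the latter has an open edge. *)
Lemma perc_le_add a b A : (forall e, 0 <= a e <= b e) -> measurable A ->
  (perc b A <= perc a A + perc (fun e => (b e - a e)%R) some_open)%E /\
  (perc a A <= perc b A + perc (fun e => (b e - a e)%R) some_open)%E.
Proof.
move=> ab mA; pose c e := b e - a e.
have a0 e : 0 <= a e by have /andP[] := ab e.
have c0 e : 0 <= c e by rewrite subr_ge0; have /andP[] := ab e.
have -> : perc b A = (perc a \x perc c)%E [set z | A (union_config z.1 z.2)].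
  by rewrite perc_union//; congr (perc _ _); apply/funext => e; rewrite /c addrC subrK.
have mU : measurable [set z : config d * config d | A (union_config z.1 z.2)].
  exact: measurable_preimage measurable_union_config mA.
have -> : perc a A = (perc a \x perc c)%E (A `*` setT).
  by rewrite product_measure1E// [X in (_ * X)%E](@probability_setT _ _ _ (perc c)) mule1.
have -> : perc c some_open = (perc a \x perc c)%E (setT `*` some_open).
  rewrite product_measure1E//; last exact: measurable_some_open.
  by rewrite [X in (X * _)%E](@probability_setT _ _ _ (perc a)) mul1e.
have mN : measurable ([set: config d] `*` some_open).
  by apply: measurableX => //; exact: measurable_some_open.
have mX : measurable (A `*` [set: config d]) by exact: measurableX.
split; (apply: (@le_trans _ _ ((perc a \x perc c)%E (_ `|` (setT `*` some_open))));
  last exact: measureU2).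
all: apply: le_measure; rewrite ?inE//; try exact: measurableU.
all: move=> [w h] /= H.
all: have [so|so] := pselect (some_open h); first by right.
  by left; split=> //; rewrite -(not_some_open w so).
by left; rewrite /= (not_some_open w so); case: H.
Qed.

(* The vertices of index less than [k] in the enumeration of the countable type
   [lattice d] play the role of a box. *)
Definition touches (k : nat) (e : edge d) : bool :=
  has (fun x => (choice.pickle x < k)%N) (enum_fset (val e)).

Lemma touchesP k e x y : is_edge e x y -> touches k e ->
  (choice.pickle x < k)%N \/ (choice.pickle y < k)%N.
Proof.
move=> exy /hasP[z]; rewrite -[_ \in _]/(z \in val e) exy !inE.
by move=> /orP[]/eqP ->; [left|right].
Qed.

(** At most one edge joins the two vertices, and [1 - expR (- c e) <= c e]. *)
Lemma perc_adjacent_le c f x z : (forall e, 0 <= c e) -> (forall x, 0 <= f x) ->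
  (forall e x y, is_edge e x y -> c e <= f (x - y)) ->
  (perc c [set w : config d | adjacent w x (x - z)%R] <= (f z)%:E)%E.
Proof.
move=> c0 f0 cf; have [->|/eqP z0] := eqVneq z 0.
  rewrite (_ : [set _ | _] = set0) ?measure0 ?lee_fin//.
  by apply/seteqP; split=> // w [e /is_edge_neq]; rewrite subr0.
have : x <> x - z.
  by rewrite -{1}(addr0 x) => /addrI /esym/eqP; rewrite oppr_eq0 => /eqP.
move=> /edge_exists[e exz].
rewrite (_ : [set _ | _] = open_event e); last first.
  apply/seteqP; split=> w; last by exists e.
  by move=> [e' /(is_edge_inj exz) <-].
rewrite [leLHS](perc_open1 e c0) lee_fin (le_trans _ (_ : c e <= _))//; last first.
  by have := cf _ _ _ exz; rewrite opprB addrC subrK.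
by have := expR_ge1Dx (- c e); lra.
Qed.

(** Union bound over the [k] codes of the box and over all displacements [z]. *)
Lemma perc_touch_some_open c f T k (S : R) : (forall e, 0 <= c e) ->
  (forall x, 0 <= f x) ->
  (forall e x y, is_edge e x y -> c e <= f (x - y)) ->
  (forall e, T e -> touches k e) ->
  (\esum_(z in [set: lattice d]) (f z)%:E <= S%:E)%E ->
  (perc (restrict_weight T c) some_open <= (k%:R * S)%:E)%E.
Proof.
move=> c0 f0 cf Tk fS.
have madj x y : measurable [set w : config d | adjacent w x y].
  rewrite (_ : [set _ | _] = \bigcup_(e in [set e : edge d | is_edge e x y])
    (open_event e : set (config d))).
    by apply: countType_bigcup_measurable => e _; exact: measurable_open_event.
  by apply/seteqP; split=> w /=; move=> [e ? ?]; exists e.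
pose G i : set (config d) := if @choice.pickle_inv (lattice d) i is Some x
  then \bigcup_z [set w : config d | adjacent w x (x - z)] else set0.
have mG i : measurable (G i).
  by rewrite /G; case: choice.pickle_inv => // x; exact: countType_bigcup_measurable.
have GS i : (perc c (G i) <= S%:E)%E.
  apply: le_trans fS; rewrite /G; case: choice.pickle_inv => [x|]; last first.
    by rewrite measure0; apply: esum_ge0 => z _; rewrite lee_fin.
  apply: (le_trans (@measure_countable_subadditive _ _ _ _ (perc c) _ _)) => //.
  by apply: le_esum => z _; exact: perc_adjacent_le.
rewrite -perc_restrict//; last exact: measurable_some_open.
apply: (@le_trans _ _ (perc c (\big[setU/set0]_(i < k) G i))).
  apply: le_measure; rewrite ?inE.
  - exact: measurable_preimage (measurable_restrict _) measurable_some_open.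
  - exact: bigsetU_measurable.
  move=> w [e /andP[Te we]].
  suff [x [y [exy xk]]] : exists x y, is_edge e x y /\ (choice.pickle x < k)%N.
    rewrite -bigcup_mkord; exists (choice.pickle x) => //.
    rewrite /G choice.pickleK_inv; exists (x - y) => //.
    by exists e => //; rewrite opprB addrC subrK.
  have [x [y exy]] := is_edge_exists e.
  have [xk|yk] := touchesP exy (Tk _ Te); first by exists x, y.
  by exists y, x; split=> //; exact: is_edge_sym.
apply: (le_trans (Boole_inequality _ _)) => //.
apply: (@le_trans _ _ (\sum_(i < k) S%:E)%E); first by apply: lee_sum => i _; exact: GS.
by rewrite sumEFin sumr_const card_ord mulr_natl.
Qed.

(** Both laws are compared with the one of weights [Num.min (a e) (b e)]; each comparison costs
    [k%:R * S], whence the factor two. *)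
Lemma perc_touch_le a b f T k (S : R) A :
  (forall e, 0 <= a e) -> (forall e, 0 <= b e) -> (forall x, 0 <= f x) ->
  (forall e x y, is_edge e x y -> `|a e - b e| <= f (x - y)) ->
  (forall e, T e -> touches k e) ->
  (\esum_(z in [set: lattice d]) (f z)%:E <= S%:E)%E -> measurable A ->
  (perc (restrict_weight T a) A <=
   perc (restrict_weight T b) A + (k%:R * S *+ 2)%:E)%E.
Proof.
move=> a0 b0 f0 abf Tk fS mA; pose m e := Num.min (a e) (b e).
have m0 e : 0 <= m e by rewrite le_min a0 b0.
have mle e : m e <= a e /\ m e <= b e by split; rewrite /m ge_min lexx ?orbT.
have rw (u : edge d -> R) : (forall e, m e <= u e) ->
    forall e, 0 <= restrict_weight T m e <= restrict_weight T u e.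
  by move=> mu e; rewrite /restrict_weight; case: ifP => _; [exact/andP|rewrite lexx].
have := (perc_le_add (rw a (fun e => (mle e).1)) mA).1.
have := (perc_le_add (rw b (fun e => (mle e).2)) mA).2.
have E (u : edge d -> R) : (fun e => restrict_weight T u e - restrict_weight T m e) =
    restrict_weight T (fun e => u e - m e).
  by apply/funext => e; rewrite /restrict_weight; case: ifP; rewrite ?subrr.
rewrite !E.
have H (u : edge d -> R) : (forall e, m e <= u e) ->
    (forall e, u e - m e <= `|a e - b e|) ->
    (perc (restrict_weight T (fun e => (u e - m e)%R)) some_open <= (k%:R * S)%:E)%E.
  move=> mu um; apply: (@perc_touch_some_open _ f) => // [e|e x y exy].
    by rewrite subr_ge0.
  exact: le_trans (um e) (abf _ _ _ exy).
have Ha : forall e, a e - m e <= `|a e - b e|.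
  move=> e; rewrite /m; case: (leP (a e) (b e)) => _; first by rewrite subrr.
  exact: ler_norm.
have Hb : forall e, b e - m e <= `|a e - b e|.
  move=> e; rewrite /m distrC; case: (leP (a e) (b e)) => _; first exact: ler_norm.
  by rewrite subrr.
move=> hb ha; apply: (le_trans ha); rewrite mulr2n EFinD addeA.
apply: leeD (H a (fun e => (mle e).1) Ha).
apply: (le_trans hb); apply: leeD => //; exact: H (fun e => (mle e).2) Hb.
Qed.

End comparison.

(** * Infinite clusters meet the rich vertices *)

Section rich_vertices.
Context {R : realType} {d : nat}.
Implicit Types (x y u v : lattice d) (w h : config d) (e : edge d).

Definition short (k : nat) : pred (edge d) := fun e => enorm R (edge_disp e) <= k%:R.

Lemma short_le k l e : (k <= l)%N -> short k e -> short l e.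
Proof. by move=> kl ke; rewrite /short (le_trans ke)// ler_nat. Qed.

Lemma short_exists e : exists k, short k e.
Proof.
exists (Num.bound (enorm R (edge_disp e))); apply/ltW/archi_boundP.
exact: sqrtr_ge0.
Qed.

Lemma short_shift k z e : short k (shift_edge z e) = short k e.
Proof.
by rewrite /short; apply: (edge_disp_shift (f := fun x => enorm R x <= k%:R)) => x;
  rewrite enormN.
Qed.

(** The bound [k] on edge lengths may depend on the vertex: any open edge of [w] is short for a
    large enough bound, so richness is constant on the clusters of [w]. *)
Definition rich w : set (lattice d) := [set x | exists k, percolates x (restrict (short k) w)].

Lemma restrict_short_le k l w e : (k <= l)%N ->
  restrict (short k) w e -> restrict (short l) w e.
Proof. by move=> kl /andP[ke we]; apply/andP; split=> //; exact: short_le ke. Qed.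

Lemma rich_adjacent w x y : rich w x -> adjacent w x y -> rich w y.
Proof.
move=> [k xk] [e exy we]; have [l el] := short_exists e.
exists (maxn k l).
apply: (percolates_connected (x := x)).
  apply: connected_adjacent; exists e => //; apply/andP; split=> //.
  exact: short_le (leq_maxr _ _) el.
by apply: percolates_mono xk => e'; apply: restrict_short_le; exact: leq_maxl.
Qed.

Lemma rich_mono w h x : (forall e, w e -> h e) -> rich w x -> rich h x.
Proof.
move=> wh [k xk]; exists k; apply: percolates_mono xk => e /andP[ke we].
by apply/andP; split=> //; exact: wh.
Qed.

Lemma restrict_short_shift k z w :
  restrict (short k) (shift_config z w) = shift_config z (restrict (short k) w).
Proof. by apply/funext => e; rewrite /restrict /shift_config short_shift. Qed.

Lemma rich_shift z w x : rich (shift_config z w) x <-> rich w (x + z).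
Proof.
split=> -[k kx]; exists k; move: kx; rewrite restrict_short_shift.
  by move=> /(percolates_shift z _ x).
by move=> kx; apply/(percolates_shift z _ x).
Qed.

Lemma measurable_rich x : measurable [set w | rich w x].
Proof.
rewrite (_ : [set _ | _] = \bigcup_k (restrict (short k) @^-1` percolates x)).
  apply: bigcup_measurable => k _.
  exact: measurable_preimage (measurable_restrict _) (measurable_percolates x).
by apply/seteqP; split=> w [k]; exists k.
Qed.

End rich_vertices.

(** * Infinite clusters without rich vertices have probability zero *)

Section bad_clusters.
Context {R : realType} {d : nat} (a b : edge d -> R).
Hypotheses (a0 : forall e, 0 <= a e) (b0 : forall e, 0 <= b e).
Hypotheses (a_shift : forall z e, a (shift_edge z e) = a e).
Hypotheses (b_shift : forall z e, b (shift_edge z e) = b e).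
Implicit Types (x y u v : lattice d) (w h : config d) (e : edge d).
Implicit Types (z : config d * config d).

Local Notation Q := (perc a \x perc b)%E.
Local Notation rich := (@rich R d).

Let un z : config d := union_config z.1 z.2.

Let measurable_un (A : set (config d)) : measurable A -> measurable [set z | A (un z)].
Proof. exact: measurable_preimage measurable_union_config. Qed.

Let measurable_1 (A : set (config d)) :
  measurable A -> measurable [set z : config d * config d | A z.1].
Proof. exact: measurable_preimage measurable_fst. Qed.

Definition bad x : set (config d * config d) :=
  [set z | percolates x (un z) /\ forall y, rich z.1 y -> ~ connected_in (un z) x y].

Lemma measurable_bad x : measurable (bad x).
Proof.
rewrite (_ : bad x = [set z | percolates x (un z)] `&`
  ~` (\bigcup_y ([set z : config d * config d | rich z.1 y] `&`
       [set z | connected_in (un z) x y]))).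
  apply: measurableI; first exact: measurable_un (measurable_percolates x).
  apply: measurableC; apply: countType_bigcup_measurable => y _.
  apply: measurableI; first exact: measurable_1 (measurable_rich y).
  exact: measurable_un (measurable_connected_in x y).
apply/seteqP; split=> z [xz H]; split=> //.
  by move=> [y _ [/H]].
by move=> y yr yx; apply: H; exists y.
Qed.

Lemma measurable_bad_rich x y :
  measurable (bad x `&` [set z : config d * config d | rich z.1 y]).
Proof.
apply: measurableI; first exact: measurable_bad.
exact: measurable_1 (measurable_rich y).
Qed.

(** Only edges with no rich endpoint are kept. Richness refers to the first sample alone, so opening
    edges in the second does not affect it. *)
Let poor z : config d := fun e => un z e && `[< forall v, v \in val e -> ~ rich z.1 v >].

Let gate z y : Prop := exists v, rich z.1 v /\ adjacent (un z) y v.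

(** The event on which [x] sends unit mass to [y] in the mass transport. *)
Let only_gate x y : set (config d * config d) :=
  [set z | [/\ percolates x (poor z), connected_in (poor z) x y &
            forall y', connected_in (poor z) x y' -> (gate z y' <-> y' = y)]].

Let measurable_poor : measurable_fun setT poor.
Proof.
apply: measurable_config_fun => e.
rewrite (_ : [set _ | _] = [set z | open_event e (un z)] `&`
  \bigcap_(v in [set` val e]) ~` [set z : config d * config d | rich z.1 v]).
  apply: measurableI; first exact: measurable_un (measurable_open_event e).
  apply: fin_bigcap_measurable => [|v _]; first exact: finite_fset.
  by apply: measurableC; exact: measurable_1 (measurable_rich v).
by apply/seteqP; split=> z /=;
  [move=> /andP[uz /asboolP H]|move=> [uz H]; apply/andP; split=> //; apply/asboolP].
Qed.

Let measurable_gate y : measurable [set z | gate z y].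
Proof.
rewrite (_ : [set _ | _] = \bigcup_v ([set z : config d * config d | rich z.1 v] `&`
   \bigcup_(e in [set e | is_edge e y v]) [set z | open_event e (un z)])).
  apply: countType_bigcup_measurable => v _.
  apply: measurableI; first exact: measurable_1 (measurable_rich v).
  apply: countType_bigcup_measurable => e _.
  exact: measurable_un (measurable_open_event e).
apply/seteqP; split=> z.
  by move=> [v [vr [e eyv ue]]]; exists v => //; split=> //; exists e.
by move=> [v _ [vr [e eyv ue]]]; exists v; split=> //; exists e.
Qed.

Let measurable_only_gate x y : measurable (only_gate x y).
Proof.
have mc y' : measurable [set z | connected_in (poor z) x y'].
  exact: measurable_preimage measurable_poor (measurable_connected_in x y').
rewrite (_ : only_gate x y = [set z | percolates x (poor z)] `&`
  [set z | connected_in (poor z) x y] `&`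
  ~` (\bigcup_y' ([set z | connected_in (poor z) x y'] `&`
      (if y' == y then ~` [set z | gate z y'] else [set z | gate z y'])))).
  apply: measurableI; first apply: measurableI => //.
    exact: measurable_preimage measurable_poor (measurable_percolates x).
  apply: measurableC; apply: countType_bigcup_measurable => y' _.
  apply: measurableI => //; case: ifP => _; last exact (measurable_gate y').
  by apply: measurableC; exact (measurable_gate y').
apply/seteqP; split=> z.
  move=> [px cxy H]; split=> // -[y' _ [/H{}H]].
  by case: eqP => [y'y|y'y]; [apply; exact: H.2|move=> /H.1].
move=> [[px cxy] H]; split=> // y' cy'; split=> [gy'|y'y]; apply: contrapT => K;
  apply: H; exists y' => //; split=> //; first by case: eqP.
by rewrite y'y eqxx /= -y'y.
Qed.

Let poor_shift v z : poor (shift_config v z.1, shift_config v z.2) = shift_config v (poor z).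
Proof.
apply/funext => e; rewrite /poor /shift_config /un /=; congr (_ && _).
apply/asbool_equiv_eq; split=> H u.
  move=> /imfsetP[t /= te ->]; have := H t te; apply: contra_not => tr.
  exact/rich_shift.
by move=> ue ur; apply: (H (u + v)); [exact: in_imfset|exact/rich_shift].
Qed.

Let gate_shift v z y : gate (shift_config v z.1, shift_config v z.2) y <-> gate z (y + v).
Proof.
split=> -[t [tr yt]].
  exists (t + v); split; first exact/rich_shift.
  exact/(adjacent_shift v (un z)).
exists (t - v); split; first by apply/rich_shift; rewrite subrK.
by apply/(adjacent_shift v (un z)); rewrite subrK.
Qed.

(** Mass transport: uniqueness of the gate gives a single recipient, the invariance of [a] and [b]
    gives translation invariance, and [y] receives mass from a whole infinite poor cluster. *)
Let only_gate_null x y : Q (only_gate x y) = 0%E.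
Proof.
apply: (mass_transport (D := only_gate)) => {x y}.
- exact: measurable_only_gate.
- move=> x y y' yy'; apply/seteqP; split=> // z [[_ cy Hy] [_ cy' Hy']].
  by apply: yy'; apply/(Hy' y cy)/(Hy y cy).
- move=> x y v; rewrite -[RHS](product_law_image (measurable_shift_config v)
    (measurable_shift_config v) (P1 := perc a) (P2 := perc b)); first last.
  + exact: measurable_only_gate.
  + by move=> A mA; exact: (perc_shift b0 (b_shift v) mA).
  + by move=> A mA; exact: (perc_shift a0 (a_shift v) mA).
  congr (Q _); apply/seteqP; split=> z; rewrite /only_gate /= poor_shift;
    move=> [px cxy H]; split.
  + exact/percolates_shift.
  + exact/connected_shift.
  + move=> y' /connected_shift cy'; have gy' := H _ cy'.
    split=> [gs|y'y]; first by apply/(@addIr _ v)/gy'/gate_shift.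
    by apply/gate_shift/gy'; rewrite y'y.
  + exact/percolates_shift.
  + exact/connected_shift.
  + move=> y'; rewrite -(subrK v y') => cy'.
    have gy' := H _ (proj2 (connected_shift v (poor z) x (y' - v)) cy').
    split=> [gs|/addIr y'y]; last by apply/gate_shift/gy'.
    by congr (_ + _); apply/gy'/gate_shift.
- move=> x y z [px cxy H]; apply: (sub_infinite_set _ px) => x' xx'.
  split; first exact: percolates_connected xx' px.
    exact: connected_trans (connected_sym xx') cxy.
  by move=> y' x'y'; apply: H; exact: connected_trans xx' x'y'.
Qed.

Let open_prob_gt0 (c : edge d -> R) e : 0 < c e -> 0 < 1 - expR (- c e).
Proof. by move=> ce; rewrite subr_gt0 -expR0 ltr_expR oppr_lt0. Qed.

Let null_of_le (c : R) (p : \bar R) : 0 < c -> (0 <= p)%E -> (c%:E * p <= 0)%E -> p = 0%E.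
Proof.
move=> c0 p0 cp; apply/eqP; rewrite eq_le p0 andbT.
by rewrite -(@lee_pmul2l _ c%:E)// mule0.
Qed.

(** Finite energy for the first sample, integrated over the second: a positive multiple of [Q A] is
    at most [Q B]. *)
Lemma insert_open_left e (A B : set (config d * config d)) : 0 < a e ->
  measurable A -> measurable B ->
  (forall w h, A (w, h) -> B (set_open e w, h)) -> Q B = 0%E -> Q A = 0%E.
Proof.
move=> ae mA mB AB B0; apply: (null_of_le (open_prob_gt0 ae)) => //.
rewrite -B0; apply: le_product_section1 => // [|h].
  exact/ltW/open_prob_gt0.
apply: insert_open => //; try exact: measurable_ysection.
by move=> w; rewrite /ysection /= !inE; exact: AB.
Qed.

Lemma insert_open_right e (A B : set (config d * config d)) : 0 < b e ->
  measurable A -> measurable B ->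
  (forall w h, A (w, h) -> B (w, set_open e h)) -> Q B = 0%E -> Q A = 0%E.
Proof.
move=> be mA mB AB B0; apply: (null_of_le (open_prob_gt0 be)) => //.
rewrite -B0; apply: le_product_section2 => // [|w].
  exact/ltW/open_prob_gt0.
apply: insert_open => //; try exact: measurable_xsection.
by move=> h; rewrite /xsection /= !inE; exact: AB.
Qed.

(* Opening [e] in the second sample makes [x] the only gate of its poor cluster. *)
Lemma bad_next_to_rich_null e x y : is_edge e x y -> 0 < b e ->
  Q (bad x `&` [set z | rich z.1 y]) = 0%E.
Proof.
move=> exy be; apply: (@insert_open_right e _ (only_gate x x) be
  (measurable_bad_rich x y) (measurable_only_gate x x) _ (only_gate_null x x)).
move=> w h [[px nr] /= ry]; set u := un (w, h) in px nr.
set z' := (w, set_open e h).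
have uE e' : un z' e' = (e' == e) || u e'.
  by rewrite /u /un /z' /union_config /set_open /= orbCA.
(* The poor cluster of [x] after the insertion is its former cluster: [e] has the rich endpoint [y],
   so it is not a poor edge, and the former cluster contains no rich vertex. *)
have poor_u v : connected_in (poor z') x v -> connected_in u x v.
  move: v; apply: (connected_ind (S := connected_in u x)); first exact: connected_refl.
  move=> p q _ xp [e' e'pq /andP[ue' /asboolP nre']]; apply: connected_step xp _.
  exists e' => //; move: ue'; rewrite uE => /orP[/eqP e'e|//].
  by case: (nre' y) => //; rewrite e'e exy !inE eqxx orbT.
have u_poor v : connected_in u x v -> connected_in (poor z') x v.
  move: v; apply: (connected_ind (S := connected_in (poor z') x)); first exact: connected_refl.
  move=> p q xp xp' [e' e'pq ue']; apply: connected_step xp' _.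
  have xq : connected_in u x q by apply: connected_step xp _; exists e'.
  exists e' => //; apply/andP; split; first by rewrite uE ue' orbT.
  apply/asboolP => v; rewrite e'pq !inE => /orP[]/eqP -> /nr; exact.
split; [|exact: connected_refl|].
  by apply: (sub_infinite_set _ px) => v; exact: u_poor.
move=> y' /poor_u xy'; split=> [[v [rv [e' e'y'v]]]|->]; last first.
  by exists y; split=> //; exists e => //; rewrite uE eqxx.
(* An open edge from the cluster of [x] to a rich vertex can only be [e], and its endpoint in that
   cluster is [x] because [y] is rich. *)
rewrite uE => /orP[/eqP e'e|ue']; last first.
  by case: (nr v rv); apply: connected_step xy' _; exists e'.
rewrite e'e in e'y'v; case: (is_edge_pair exy e'y'v) => -[y'E _] //.
by case: (nr y ry); rewrite -y'E.
Qed.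

(* Either [u] lies in the bad cluster of [x], and is next to the rich vertex [v],
   or opening [e] in the first sample makes [u] rich and leaves the cluster of
   [x] unchanged. *)
Lemma bad_rich_step e x u v : is_edge e u v -> 0 < a e -> 0 < b e ->
  Q (bad x `&` [set z | rich z.1 u]) = 0%E ->
  Q (bad x `&` [set z | rich z.1 v]) = 0%E.
Proof.
move=> euv ae be Qu; pose C := [set z | connected_in (un z) x u].
have mC : measurable C by exact: measurable_un (measurable_connected_in x u).
have mv y := measurable_bad_rich y v.
have mA1 : measurable ((bad x `&` [set z | rich z.1 v]) `&` C) by exact: measurableI.
have mA2 : measurable ((bad x `&` [set z | rich z.1 v]) `&` ~` C).
  by apply: measurableI => //; exact: measurableC.
have Q1 : Q ((bad x `&` [set z | rich z.1 v]) `&` C) = 0%E.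
  apply: (@subset_measure0 _ _ _ Q _ (bad u `&` [set z | rich z.1 v])) => //.
    move=> z [[[px nr] rv] xu]; split=> //; split.
      exact: percolates_connected xu px.
    by move=> y /nr + uy; apply; exact: connected_trans xu uy.
  exact: bad_next_to_rich_null euv be.
have Q2 : Q ((bad x `&` [set z | rich z.1 v]) `&` ~` C) = 0%E.
  apply: (@insert_open_left e _ (bad x `&` [set z | rich z.1 u]) ae mA2
    (measurable_bad_rich x u) _ Qu).
  move=> w h [[[px nr] rv] /= nxu]; rewrite /C /= in nxu.
  set u0 := un (w, h) in px nr nxu.
  set u1 := un (set_open e w, h).
  have nxv := nr v rv; rewrite -/u0 in nxv.
  have uE e' : u1 e' = (e' == e) || u0 e'.
    by rewrite /u0 /u1 /un /union_config /set_open /= orbA.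
  (* Neither endpoint of [e] lies in the cluster of [x]: not [u], by the case under study, and not
     [v], which is rich. Hence that cluster does not see the opening of [e]. *)
  have ne p q e' : connected_in u0 x p -> is_edge e' p q -> e' <> e.
    move=> xp + e'e; rewrite e'e => /(is_edge_pair euv)[] [pE _]; rewrite pE in xp.
      exact: nxu.
    exact: nxv.
  have u1_u0 y : connected_in u1 x y -> connected_in u0 x y.
    move: y; apply: (connected_ind (S := connected_in u0 x)); first exact: connected_refl.
    move=> p q _ xp [e' e'pq]; rewrite uE => /orP[/eqP/(ne _ _ _ xp e'pq)//|ue'].
    by apply: connected_step xp _; exists e'.
  have rw : rich (set_open e w) v.
    by apply: rich_mono rv => e' /= we'; rewrite /set_open we' orbT.
  split; last first.
    apply: (rich_adjacent rw); exists e; first exact: is_edge_sym.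
    by rewrite /set_open eqxx.
  split; first by apply: percolates_mono px => e' ue'; rewrite -/u1 uE ue' orbT.
  (* A vertex [y] of the cluster of [x] that is rich after the insertion was rich before: its
     cluster of edges of length at most [k] stays inside the cluster of [x], hence avoids [e]. *)
  move=> y [k yk] /u1_u0 xy; apply: (nr y) => //; exists k.
  apply: (sub_infinite_set _ yk).
  apply: (connected_ind (S := open_cluster (restrict (short k) w) y)).
    exact: connected_refl.
  move=> p q _ yp [e' e'pq /andP[ke' we']]; apply: (connected_step yp).
  exists e' => //; apply/andP; split=> //.
  move: we'; rewrite /set_open => /orP[/eqP|//].
  have xp : connected_in u0 x p.
    apply: connected_trans xy _; apply: connected_mono yp => e'' /andP[_ we''].
    by apply/orP; left; exact: we''.
  by move=> /(ne _ _ _ xp e'pq).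
have -> : bad x `&` [set z | rich z.1 v] =
    ((bad x `&` [set z | rich z.1 v]) `&` C) `|` ((bad x `&` [set z | rich z.1 v]) `&` ~` C).
  by rewrite -setIUr setUv setIT.
rewrite measureU//; first by rewrite [X in (X + _)%E]Q1 [X in (_ + X)%E]Q2 adde0.
by rewrite setIACA setICr setI0.
Qed.

(** Trivial steps accommodate the paths of [irreducible], whose increments may be zero. *)
Hypothesis edges_irreducible : forall x y, exists (n : nat) (p : nat -> lattice d),
  [/\ p 0%N = x, p n = y & forall i, (i < n)%N ->
      p i = p i.+1 \/ exists e, [/\ is_edge e (p i) (p i.+1), 0 < a e & 0 < b e]].

(** Induction along the path from [x] to [y]: a bad [x] is not rich itself, and [bad_rich_step]
    carries nullity across each edge. *)
Lemma bad_rich_null x y : Q (bad x `&` [set z | rich z.1 y]) = 0%E.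
Proof.
have [n [p [p0 <- pS]]] := edges_irreducible x y.
elim: n pS => [_|n IH pS].
  rewrite p0 (_ : _ `&` _ = set0) ?measure0//.
  by apply/seteqP; split=> // z [[_ nr] /nr]; apply; exact: connected_refl.
have Qn : Q (bad x `&` [set z | rich z.1 (p n)]) = 0%E.
  by apply: IH => i ni; apply: pS; rewrite ltnW.
have [<-//|[e [epp ae be]]] := pS n (ltnSn n).
exact: bad_rich_step epp ae be Qn.
Qed.

(** Almost surely some vertex percolates by edges of length at most [k], hence is rich; there are
    countably many candidates. *)
Lemma bad_null x k : perc a (restrict (@short R d k) @^-1` supercritical) = 1%E ->
  Q (bad x) = 0%E.
Proof.
move=> sup.
set S := restrict (@short R d k) @^-1` supercritical in sup.
have mS : measurable S.
  exact: measurable_preimage (measurable_restrict _) measurable_supercritical.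
have mr y := measurable_bad_rich x y.
have mS1 : measurable [set z : config d * config d | (~` S) z.1].
  by apply: measurable_1; exact: measurableC.
apply: (@subset_measure0 _ _ _ Q _ ([set z | (~` S) z.1] `|`
    \bigcup_y (bad x `&` [set z | rich z.1 y]))) => //.
- exact: measurable_bad.
- by apply: measurableU => //; exact: countType_bigcup_measurable.
- move=> z bz; have [[y _ py]|nS] := pselect (S z.1); last by left.
  by right; exists y => //; split=> //; exists k.
apply: null_set_setU => //.
- exact: countType_bigcup_measurable.
- rewrite (_ : [set z | _] = (~` S) `*` setT); last by apply/seteqP; split=> z //= [].
  transitivity (perc a (~` S) * perc b setT)%E.
    exact: product_measure1E (measurableC mS) measurableT.
  by rewrite [X in (X * _)%E](probability_setC (perc a) mS) sup subee// mul0e.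
- by apply: measure_countable_null => // y; exact: bad_rich_null.
Qed.

End bad_clusters.

(** * Semicontinuity of theta *)

Lemma finite_enorm_ball (R : realType) (d k : nat) :
  finite_set [set x : lattice d | enorm R x <= k%:R].
Proof.
(* Each coordinate lies between [-k] and [k]; adding [k] encodes it by one of [k + k + 1] values. *)
pose g (f : {ffun 'I_d -> 'I_(k + k).+1}) : lattice d := \row_i ((f i)%:Z - k%:Z).
apply: (@sub_finite_set _ _ (g @` setT)); last by apply: finite_image; exact: finite_finset.
move=> x /= xk; exists [ffun i => inord (absz (x 0 i + k%:Z))] => //.
have xik i : `|x 0 i| <= k%:Z.
  rewrite -(ler_int R) intr_norm (le_trans _ xk)// /enorm -sqrtr_sqr ler_sqrt.
    rewrite (bigD1 i)//= lerDl sumr_ge0// => j _; exact: sqr_ge0.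
  by apply: sumr_ge0 => j _; exact: sqr_ge0.
apply/rowP => i; rewrite !mxE ffunE inordK; have := xik i; lia.
Qed.

Lemma esumZ_le (R : realType) (T : choiceType) (c : R) (f : T -> R) :
  0 <= c -> (forall x, 0 <= f x) ->
  (\esum_(x in setT) (c * f x)%:E <= c%:E * \esum_(x in setT) (f x)%:E)%E.
Proof.
move=> c0 f0; apply: ge_ereal_sup => _ [X [finX _] <-].
rewrite (_ : (\sum_(x \in X) (c * f x)%:E)%E = (c%:E * \sum_(x \in X) (f x)%:E)%E).
  by apply: lee_wpmul2l; rewrite ?lee_fin//; apply: esum_ge; exists X.
rewrite !fsbig_finite//= ge0_sume_distrr// => x _.
by rewrite lee_fin.
Qed.

Section product_sections.
Context d1 d2 (T1 : measurableType d1) (T2 : measurableType d2) (R : realType).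
Local Open Scope ereal_scope.

Lemma le_product_sectionD (P1 : probability T1 R) (P2 P2' : probability T2 R) (c : R)
    (A : set (T1 * T2)) : (0 <= c)%R -> measurable A ->
  (forall x, P2 (xsection A x) <= P2' (xsection A x) + c%:E) ->
  (P1 \x P2) A <= (P1 \x P2') A + c%:E.
Proof.
move=> c0 mA h; rewrite /product_measure1.
rewrite -[in leRHS](mule1 c%:E) -(probability_setT P1) -integral_cst// -ge0_integralD//; last first.
  exact: measurable_fun_xsection.
apply: ge0_le_integral => //.
- exact: measurable_fun_xsection.
- by apply: emeasurable_funD => //; exact: measurable_fun_xsection.
- by move=> x _; exact: h.
Qed.

End product_sections.

(** * Confinement of the cluster of the origin to a box *)

Section confinement.
Context {R : realType} {d : nat}.
Implicit Types (w : config d) (x y : lattice d).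

Definition confined (k : nat) : set (config d) :=
  [set w : config d | forall y, connected_in w 0 y -> (choice.pickle y < k)%N].

Lemma measurable_confined k : measurable (confined k).
Proof.
rewrite (_ : confined k = ~` (\bigcup_(y in [set y | (k <= choice.pickle y)%N])
    [set w : config d | connected_in w 0 y])).
  apply: measurableC; apply: countType_bigcup_measurable => y _.
  exact: measurable_connected_in.
apply/seteqP; split=> w.
  by move=> H [y /= ky /H]; rewrite ltnNge ky.
by move=> H y wy; rewrite ltnNge; apply/negP => ky; apply: H; exists y.
Qed.

Lemma bigcup_confined : \bigcup_k confined k = ~` percolates 0.
Proof.
apply/seteqP; split=> w.
  move=> [k _ H] infw; apply: infw.
  apply: (@sub_finite_set _ _ ((@choice.pickle (lattice d)) @^-1` `I_k)).
    by move=> y /H.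
  apply: finite_preimage; last exact: finite_II.
  by move=> u v _ _; exact: (pcan_inj choice.pickleK).
move=> /contrapT/finite_fsetP[F FE].
exists (\max_(y <- F) choice.pickle y).+1 => // y wy; rewrite ltnS.
have yF : y \in F.
  have : [set` F] y by rewrite -FE.
  by [].
by apply: leq_bigmax_seq.
Qed.

(** If the restricted cluster stays in the box, every open edge at one of its vertices touches the
    box and so survives the restriction. *)
Lemma confined_restrict k w : confined k (restrict (touches k) w) <-> confined k w.
Proof.
split=> H y wy; last first.
  by apply: H; apply: connected_mono wy => e /andP[].
apply: (H); move: y wy; pose r := restrict (touches k) w.
apply: (connected_ind (S := connected_in r 0)); first exact: connected_refl.
move=> p q _ rp [e epq we]; apply: (connected_step rp); exists e => //.
apply/andP; split=> //; apply/hasP; exists p; last exact: H.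
by rewrite -[_ \in _]/(p \in val e) epq !inE eqxx.
Qed.

Lemma perc_confined_restrict (a : edge d -> R) k : (forall e, 0 <= a e) ->
  perc a (confined k) = perc (restrict_weight (touches k) a) (confined k).
Proof.
move=> a0; rewrite -perc_restrict//; last exact: measurable_confined.
by congr (perc a _); apply/seteqP; split=> w /confined_restrict.
Qed.

(** Continuity from below: the increasing events [confined k] exhaust the complement of
    percolation. *)
Lemma confined_near (a : edge d -> R) (eps : R) : 0 < eps ->
  exists k, (1 - perc a (percolates 0%R) <= perc a (confined k) + eps%:E)%E.
Proof.
move=> eps0.
have mI : measurable (percolates (0 : lattice d)) by exact: measurable_percolates.
have := @nondecreasing_cvg_mu _ _ _ (perc a) confined measurable_confined.
rewrite bigcup_confined => /(_ (measurableC mI)) H.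
have {}H : perc a \o confined @ \oo --> (perc a (~` percolates 0)).
  apply: H => m n mn; apply/subsetPset => w H y wy.
  exact: leq_trans (H y wy) mn.
have fin A : measurable A -> perc a A \is a fin_num by exact: fin_num_measure.
move: H; rewrite (probability_setC (perc a) mI) -(fineK (fin _ mI)) -EFinB.
move=> /fine_cvgP[_ /cvgrPdist_le/(_ eps eps0)[k _ /(_ k (leqnn k)) /= H]].
exists k; rewrite -(fineK (fin _ (measurable_confined k))) -EFinD lee_fin.
by have := le_trans (ler_norm _) H; lra.
Qed.

End confinement.

Lemma small_multiple (R : realType) (k : nat) (eps : R) : 0 < eps ->
  exists2 delta : R, 0 < delta & k%:R * delta *+ 2 <= eps.
Proof.
move=> eps0; have k1 : 0 < k%:R *+ 2 + 1 :> R by rewrite ltr_wpDl// mulrn_wge0.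
exists (eps / (k%:R *+ 2 + 1)); first by rewrite divr_gt0.
have := divr_gt0 eps0 k1; have : eps / (k%:R *+ 2 + 1) * (k%:R *+ 2 + 1) = eps.
  by rewrite divfK// gt_eqF.
lra.
Qed.

(** * Bounds along the sequence of kernels *)

Section convergence.
Context {R : realType} {d : nat} (J : lattice d -> R) (J_ : nat -> lattice d -> R).
Context (beta : R) (beta_ : nat -> R).
Hypotheses (hJ : is_kernel J) (hJ_ : forall n, is_kernel (J_ n)).
Hypotheses (beta0 : 0 <= beta) (hbeta_ : forall n, 0 < beta_ n).
Hypothesis hJcvg : cvg_L1 J_ J.
Hypothesis hbetacvg : beta_ n @[n --> \oo] --> beta.
Implicit Types (x y z : lattice d) (e : edge d) (b : R) (K : lattice d -> R).

Definition bond (b : R) (K : lattice d -> R) : edge d -> R := fun e => b * K (edge_disp e).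

Lemma bond_ge0 b K e : 0 <= b -> is_kernel K -> 0 <= bond b K e.
Proof. by move=> b0 hK; apply: mulr_ge0 => //; exact: kernel_ge0. Qed.

Lemma bondE b K e x y : is_kernel K -> is_edge e x y -> bond b K e = b * K (x - y).
Proof.
move=> hK exy; rewrite /bond; congr (_ * _); apply: (edge_disp_even (f := K) _ exy) => u.
exact: kernelN.
Qed.

Lemma bond_shift b K z e : is_kernel K -> bond b K (shift_edge z e) = bond b K e.
Proof.
move=> hK; rewrite /bond; congr (_ * _); apply: (edge_disp_shift (f := K)) => u.
exact: kernelN.
Qed.

Lemma theta_bond b K : 0 <= b -> is_kernel K ->
  (theta b K)%:E = perc (bond b K) (percolates 0).
Proof.
move=> b0 hK; apply: theta_perc => // x; first exact: kernel_ge0.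
exact: kernelN.
Qed.

Lemma truncation_kernel K N : is_kernel K -> is_kernel (truncation K N).
Proof.
move=> hK; have K0 := kernel_ge0 hK; split.
- by move=> x; rewrite /truncation; case: ifP.
- move=> s x; rewrite /truncation (kernel_perm hK).
  have -> // : enorm R (col_perm s x) = enorm R x.
  rewrite /enorm; congr Num.sqrt; rewrite [RHS](reindex_inj (@perm_inj _ s)).
  by apply: eq_bigr => i _; rewrite mxE.
- move=> b x; rewrite /truncation (kernel_flip hK).
  have -> // : enorm R (flip_signs b x) = enorm R x.
  rewrite /enorm; congr Num.sqrt; apply: eq_bigr => i _; rewrite mxE.
  by case: ifP => // _; rewrite rmorphN sqrrN.
apply: le_lt_trans (kernel_integrable hK); apply: le_esum => x _.
by rewrite lee_fin /truncation; case: ifP.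
Qed.

Lemma L1_dist_near (delta : R) : 0 < delta -> \forall n \near \oo,
  (\esum_(z in [set: lattice d]) `|beta_ n * J_ n z - beta * J z|%:E <= delta%:E)%E.
Proof.
move=> delta0.
have M0 : (0 <= \esum_(z in [set: lattice d]) (J z)%:E)%E.
  by apply: esum_ge0 => z _; rewrite lee_fin kernel_ge0.
have Mfin : \esum_(z in [set: lattice d]) (J z)%:E \is a fin_num.
  by rewrite ge0_fin_numE//; exact: kernel_integrable.
pose M := fine (\esum_(z in [set: lattice d]) (J z)%:E).
have ME : \esum_(z in [set: lattice d]) (J z)%:E = M%:E by rewrite fineK.
have M0' : 0 <= M by rewrite -lee_fin -ME.
(* Once [beta_ n <= beta + 1], and with [M] the total mass of [J], each of the two error terms is at
   most half of [delta]; the added 1 keeps the denominators positive. *)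
pose d1 := delta / 2 / (beta + 1).
pose d2 := delta / 2 / (M + 1).
have b1 : 0 < beta + 1 by rewrite ltr_wpDl.
have M1 : 0 < M + 1 by rewrite ltr_wpDl.
have d10 : 0 < d1 by rewrite !divr_gt0.
have d20 : 0 < d2 by rewrite !divr_gt0.
have /fine_cvgP[fin s0] := hJcvg.
near=> n.
have b2 : `|beta_ n - beta| <= d2.
  by near: n; exact: cvgr_distC_le.
have b3 : `|beta_ n - beta| <= 1.
  by near: n; apply: cvgr_distC_le.
have sfin : \esum_(z in [set: lattice d]) `|J_ n z - J z|%:E \is a fin_num.
  by near: n.
have sle : (\esum_(z in [set: lattice d]) `|J_ n z - J z|%:E <= d1%:E)%E.
  rewrite -(fineK sfin) lee_fin; apply: le_trans (ler_norm _) _.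
  by rewrite -[X in `|X|]subr0; near: n; exact: cvgr_distC_le.
have bn : 0 <= beta_ n by exact: ltW.
apply: (@le_trans _ _ (\esum_(z in [set: lattice d])
    ((beta_ n * `|J_ n z - J z|)%:E + (`|beta_ n - beta| * J z)%:E))%E).
  apply: le_esum => z _; rewrite -EFinD lee_fin.
  have -> : beta_ n * J_ n z - beta * J z =
      beta_ n * (J_ n z - J z) + (beta_ n - beta) * J z by ring.
  apply: (le_trans (ler_normD _ _)); rewrite !normrM (ger0_norm bn).
  by rewrite (ger0_norm (kernel_ge0 hJ z)).
rewrite esumD; first last.
- by move=> z _; rewrite lee_fin mulr_ge0//; exact: kernel_ge0.
- by move=> z _; rewrite lee_fin mulr_ge0.
apply: (@le_trans _ _ ((beta_ n * d1)%:E + (`|beta_ n - beta| * M)%:E)%E).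
  apply: leeD.
    apply: (le_trans (esumZ_le _ _)) => //.
    by rewrite EFinM; apply: lee_wpmul2l; rewrite ?lee_fin.
  apply: (le_trans (esumZ_le _ _)) => //; first exact: kernel_ge0.
  by rewrite ME EFinM.
rewrite -EFinD lee_fin (_ : delta = (beta + 1) * d1 + d2 * (M + 1)); last first.
  by rewrite /d1 /d2; field; rewrite !gt_eqF.
apply: lerD.
  apply: ler_wpM2r; first exact: ltW.
  by have := ler_norm (beta_ n - beta); lra.
by apply: ler_pM => //; rewrite lerDl.
Unshelve. all: by end_near. Qed.

(** Some box confines the cluster of the origin with probability close to [1 - theta beta J]. This
    event depends only on edges touching the box, so it is nearly as likely under [J_ n], and it
    excludes percolation. *)
Lemma theta_upper (eps : R) : 0 < eps ->
  \forall n \near \oo, theta (beta_ n) (J_ n) <= theta beta J + eps.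
Proof.
move=> eps0; have e2 : 0 < eps / 2 by rewrite divr_gt0.
have [k] := confined_near (bond beta J) e2.
have a0 e : 0 <= bond beta J e by exact: bond_ge0.
rewrite -theta_bond// => hk.
have [delta delta0 kdelta] := small_multiple k e2.
have H := L1_dist_near delta0.
near=> n.
have Hn : (\esum_(z in [set: lattice d])
    `|beta_ n * J_ n z - beta * J z|%:E <= delta%:E)%E by near: n.
have bn : 0 <= beta_ n by exact: ltW.
have an0 e : 0 <= bond (beta_ n) (J_ n) e by exact: bond_ge0.
have mc := @measurable_confined d k.
have cmp : (perc (bond beta J) (confined k) <=
    perc (bond (beta_ n) (J_ n)) (confined k) + (k%:R * delta *+ 2)%:E)%E.
  rewrite (perc_confined_restrict k a0) (perc_confined_restrict k an0).
  apply: (@perc_touch_le _ _ _ _ (fun z => `|beta_ n * J_ n z - beta * J z|)) => //.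
  by move=> e x y exy; rewrite !(bondE _ _ exy)// distrC.
have disj : (perc (bond (beta_ n) (J_ n)) (confined k) <= 1 - (theta (beta_ n) (J_ n))%:E)%E.
  rewrite theta_bond//.
  rewrite -(probability_setC (perc (bond (beta_ n) (J_ n))) (measurable_percolates 0)).
  rewrite -bigcup_confined; apply: le_measure; rewrite ?inE//.
    exact: bigcup_measurable (fun k _ => measurable_confined k).
  exact: bigcup_sup.
have := le_trans hk (leeD2r _ (le_trans cmp (leeD2r _ disj))).
rewrite -!EFinB -!EFinD lee_fin.
move: kdelta; lra.
Unshelve. all: by end_near. Qed.

(** * Lower bound when a truncation percolates at some [b' < beta] *)

Section lower.
Variables (b' : R) (N : nat).
Hypotheses (b'0 : 0 < b') (b'beta : b' < beta) (hirr : irreducible J).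
Hypothesis theta_trunc : 0 < theta b' (truncation J N).

Let a := bond b' J.
Let b := bond (beta - b') J.

Let a0 e : 0 <= a e.
Proof. by apply: bond_ge0 => //; exact: ltW. Qed.

Let b0 e : 0 <= b e.
Proof. by apply: bond_ge0 => //; rewrite subr_ge0 ltW. Qed.

Let edges_irreducible x y : exists (n : nat) (p : nat -> lattice d),
  [/\ p 0%N = x, p n = y & forall i, (i < n)%N ->
      p i = p i.+1 \/ exists e, [/\ is_edge e (p i) (p i.+1), 0 < a e & 0 < b e]].
Proof.
have [n [p [p0 pn pS]]] := hirr (y - x); exists n, (fun i => x + p i).
split; [by rewrite p0 addr0|by rewrite pn addrC subrK|move=> i ni].
have [/eqP|/eqP xi] := eqVneq (x + p i) (x + p i.+1); first by move=> /eqP; left.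
right; have [e exi] := edge_exists xi; exists e.
have Jpos : 0 < J (x + p i - (x + p i.+1)).
  rewrite opprD addrACA subrr add0r -opprB kernelN//.
  by have := pS i.+1; rewrite ltnS ni; apply.
split=> //; rewrite /a /b (bondE _ _ exi)// mulr_gt0//.
by rewrite subr_gt0.
Qed.

Let trunc_weight : restrict_weight (@short R d N) a = bond b' (truncation J N).
Proof.
apply/funext => e; rewrite /restrict_weight /a /bond /truncation /short.
by case: ifP => //; rewrite mulr0.
Qed.

(** The truncated kernel percolates from the origin with positive probability at [b']; the zero-one
    law makes the existence of an infinite cluster almost sure. *)
Let supercritical_trunc :
  perc a (restrict (@short R d N) @^-1` supercritical) = 1%E.
Proof.
have mS := @measurable_supercritical d.
have r0 e : 0 <= restrict_weight (@short R d N) a e by rewrite /restrict_weight; case: ifP.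
rewrite perc_restrict//; apply: supercritical_zero_one => //.
apply: (@lt_le_trans _ _ (theta b' (truncation J N))%:E); first by rewrite lte_fin.
rewrite theta_bond; [|exact: ltW|exact: truncation_kernel].
rewrite trunc_weight; apply: le_measure; rewrite ?inE//.
  exact: measurable_percolates.
by move=> w w0; exists 0.
Qed.

Local Notation Q := (perc a \x perc b)%E.

Let Qbad : Q (@bad R d 0) = 0%E.
Proof.
apply: (bad_null a0 b0 _ _ edges_irreducible _ supercritical_trunc) => z e.
- exact: bond_shift.
- exact: bond_shift.
Qed.

Let un (z : config d * config d) : config d := union_config z.1 z.2.

Let good : set (config d * config d) :=
  [set z | exists2 x, connected_in (un z) 0 x & percolates x z.1].

Let measurable_good : measurable good.
Proof.
rewrite (_ : good = \bigcup_x ([set z | connected_in (un z) 0 x] `&`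
    [set z : config d * config d | percolates x z.1])).
  apply: countType_bigcup_measurable => x _; apply: measurableI.
    exact: measurable_preimage measurable_union_config (measurable_connected_in 0 x).
  exact: measurable_preimage measurable_fst (measurable_percolates x).
by apply/seteqP; split=> z [x]; [exists x|move=> _ []; exists x].
Qed.

Let near_edges k : pred (edge d) := fun e => touches k e && @short R d k e.

(** The second sample is cut down to short edges touching a box, where a small L1 perturbation costs
    little; the first keeps all short edges, where the weights of [J_ n] eventually dominate. *)
Let good_at k : set (config d * config d) :=
  [set z | good (restrict (@short R d k) z.1, restrict (near_edges k) z.2)].

Let measurable_good_at k : measurable (good_at k).
Proof.
have mf : measurable_fun setT (fun z : config d * config d =>
    (restrict (@short R d k) z.1, restrict (near_edges k) z.2)).
  by apply: measurable_fun_pair; apply: measurableT_comp => //; exact: measurable_restrict.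
exact: measurable_preimage mf measurable_good.
Qed.

Let near_edges_le k l e : (k <= l)%N -> near_edges k e -> near_edges l e.
Proof.
move=> kl /andP[/hasP[x xe xk] ke]; apply/andP; split; last exact: short_le ke.
by apply/hasP; exists x => //; exact: leq_trans xk kl.
Qed.

Let good_mono (w h w' h' : config d) : (forall e, w e -> w' e) -> (forall e, h e -> h' e) ->
  good (w, h) -> good (w', h').
Proof.
move=> ww hh [x x0 px]; exists x; last exact: percolates_mono px.
apply: connected_mono x0 => e; rewrite /un /union_config /=.
by move=> /orP[/ww ->|/hh ->]; rewrite ?orbT.
Qed.

Let good_at_le k l : (k <= l)%N -> good_at k `<=` good_at l.
Proof.
move=> kl z; apply: good_mono => e; first exact: restrict_short_le.
by move=> /andP[ke we]; apply/andP; split=> //; exact: near_edges_le ke.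
Qed.

(** Off [bad], the origin is joined to a rich vertex by a finite path, and a large enough bound
    retains all its edges. *)
Let percolates_good : [set z | percolates 0 (un z)] `<=`
  @bad R d 0 `|` \bigcup_k good_at k.
Proof.
move=> z p0; have [bz|nbz] := pselect (bad (R := R) 0 z); [by left|right].
have [x [[k kx] cx]] : exists x, rich (R := R) z.1 x /\ connected_in (un z) 0 x.
  apply: contrapT => H; apply: nbz; split=> // y ry cy; apply: H.
  by exists y.
pose u k := un (restrict (@short R d k) z.1, restrict (near_edges k) z.2).
have [l ul] : exists l, connected_in (u l) 0 x.
  have u_le k1 k2 e : (k1 <= k2)%N -> u k1 e -> u k2 e.
    move=> k12 /orP[H|/andP[/= H1 H2]]; apply/orP; [left|right].
      exact: restrict_short_le H.
    by apply/andP; split=> //; exact: near_edges_le H1.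
  move: x cx {kx}; apply: (connected_ind (S := fun x => exists l, connected_in (u l) 0 x)).
    by exists 0%N; exact: connected_refl.
  move=> p q _ [l lp] [e epq ue]; have [m me] := short_exists (R := R) e.
  (* [r] is at least the bound [l] for the path so far and the length bound [m] for [e], and it
     exceeds the code of [p], so that [e] is short and touches the box. *)
  pose r := maxn l (maxn m (choice.pickle p).+1); exists r.
  have sr : short (R := R) r e.
    by apply: short_le me; rewrite /r leq_max; apply/orP; right; exact: leq_maxl.
  apply: (connected_step (y := p)).
    by apply: connected_mono lp => e'; apply: u_le; exact: leq_maxl.
  exists e => //; move: ue; rewrite /u /un /union_config /restrict /= sr /near_edges sr andbT.
  suff -> : touches r e by [].
  apply/hasP; exists p; first by rewrite -[_ \in _]/(p \in val e) epq !inE eqxx.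
  by rewrite /r !leq_max leqnn !orbT.
exists (maxn k l) => //; exists x.
  apply: connected_mono ul => e /orP[H|/andP[/= H1 H2]]; apply/orP; [left|right].
    by apply: restrict_short_le H; exact: leq_maxr.
  by apply/andP; split=> //; apply: near_edges_le H1; exact: leq_maxr.
by apply: percolates_mono kx => e; apply: restrict_short_le; exact: leq_maxl.
Qed.

(** Continuity from below along [good_at], since [bad] is null. *)
Let good_near (eps : R) : 0 < eps ->
  exists k, ((theta beta J)%:E <= Q (good_at k) + eps%:E)%E.
Proof.
move=> eps0.
have mB : measurable (@bad R d 0) by exact: measurable_bad.
have mG : measurable (\bigcup_k good_at k) by exact: bigcup_measurable.
have mP : measurable [set z | percolates 0 (un z)].
  exact: measurable_preimage measurable_union_config (measurable_percolates 0).
have tG : ((theta beta J)%:E <= Q (\bigcup_k good_at k))%E.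
  rewrite theta_bond// (_ : bond beta J = fun e => a e + b e); last first.
    by apply/funext => e; rewrite /a /b /bond -mulrDl addrC subrK.
  rewrite -(perc_union a0 b0 (measurable_percolates 0)).
  rewrite -[leRHS]add0e -[X in (X + _)%E]Qbad.
  apply: le_trans (measureU2 _ mB mG).
  by apply: le_measure; rewrite ?inE;
    [exact: mP|exact: measurableU|exact: percolates_good].
have nd : nondecreasing_seq good_at.
  by move=> m n mn; apply/subsetPset; exact: good_at_le.
have fin A : measurable A -> Q A \is a fin_num.
  move=> mA; rewrite ge0_fin_numE//.
  by apply: (le_lt_trans (probability_le1 _ mA)); exact: ltry.
have cvQ : Q \o good_at @ \oo --> Q (\bigcup_k good_at k).
  exact: (@nondecreasing_cvg_mu _ _ _ Q good_at measurable_good_at mG nd).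
rewrite -(fineK (fin _ mG)) in cvQ.
move: cvQ => /fine_cvgP[_ /cvgrPdist_le/(_ eps eps0)[k _ /(_ k (leqnn k)) /= H]].
exists k; apply: (le_trans tG).
rewrite -(fineK (fin _ mG)) -(fineK (fin _ (measurable_good_at k))) -EFinD lee_fin.
by have := le_trans (ler_norm _) H; lra.
Qed.

Let pointwise_near z : \forall n \near \oo, b' * J z <= beta_ n * J_ n z.
Proof.
have Jz0 := kernel_ge0 hJ z; have [Jz|Jz] := leP (J z) 0.
  near=> n; have -> : J z = 0 by apply/eqP; rewrite eq_le Jz.
  by rewrite mulr0 mulr_ge0//; [exact: ltW|exact: kernel_ge0].
(* An error of at most [(beta - b') * J z] keeps [beta_ n * J_ n z] above
   [beta * J z - (beta - b') * J z], which is [b' * J z]. *)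
have dz : 0 < (beta - b') * J z by rewrite mulr_gt0// subr_gt0.
have H := L1_dist_near dz.
near=> n.
have Hn : (\esum_(z in [set: lattice d])
    `|beta_ n * J_ n z - beta * J z|%:E <= ((beta - b') * J z)%:E)%E by near: n.
have : (`|beta_ n * J_ n z - beta * J z|%:E <= ((beta - b') * J z)%:E)%E.
  apply: le_trans Hn; apply: esum_ge; exists [set z]; last by rewrite fsbig_set1.
  by split=> //; exact: finite_set1.
rewrite lee_fin ler_norml => /andP[+ _]; lra.
Unshelve. all: by end_near. Qed.

(** Only finitely many displacements are short, so the pointwise bounds eventually hold
    simultaneously. *)
Let short_near k : \forall n \near \oo, forall e, restrict_weight (@short R d k) a e <=
  bond (beta_ n) (J_ n) e.
Proof.
have /finite_fsetP[F FE] := finite_enorm_ball R d k.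
have HF : \forall n \near \oo, forall z, z \in enum_fset F -> b' * J z <= beta_ n * J_ n z.
  elim: (enum_fset F) => [|z s IH]; first by near=> n.
  have Hz := pointwise_near z; near=> n => z'; rewrite inE => /orP[/eqP ->|].
    by near: n.
  by move: z'; near: n.
near=> n => e; rewrite /restrict_weight /short; case: ifP => [ek|_]; last first.
  by apply: bond_ge0 => //; exact: ltW.
have Hn : forall z, z \in enum_fset F -> b' * J z <= beta_ n * J_ n z by near: n.
apply: Hn; have : [set` F] (edge_disp e) by rewrite -FE.
by [].
Unshelve. all: by end_near. Qed.

(** What remains of the weights at [beta] once the first sample uses short edges only; on short
    edges it equals [b]. Its distance to the analogous remainder for [J_ n] is that of the full
    weights. *)
Let long_weight k e := bond beta J e - restrict_weight (@short R d k) a e.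

(** The law for [J_ n] splits into the same first sample and a remainder [nu], and [good] for these
    implies percolation from the origin. Replacing [nu] by [long_weight] on the edges of
    [near_edges k] costs [k%:R * delta *+ 2]. *)
Let perc_good_le k n (delta : R) :
  (\esum_(z in [set: lattice d]) `|beta_ n * J_ n z - beta * J z|%:E <= delta%:E)%E ->
  (forall e, restrict_weight (@short R d k) a e <= bond (beta_ n) (J_ n) e) ->
  ((perc (restrict_weight (@short R d k) a) \x
      perc (restrict_weight (near_edges k) (long_weight k)))%E good <=
    (theta (beta_ n) (J_ n) + k%:R * delta *+ 2)%:E)%E.
Proof.
move=> Hn an; pose ak := restrict_weight (@short R d k) a.
have bn : 0 <= beta_ n by exact: ltW.
have ak0 e : 0 <= ak e by rewrite /ak /restrict_weight; case: ifP.
have bk0 e : 0 <= long_weight k e.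
  rewrite /long_weight /restrict_weight subr_ge0; case: ifP => _; last exact: bond_ge0.
  by rewrite ler_wpM2r ?(kernel_ge0 hJ)// ltW.
pose nu e := bond (beta_ n) (J_ n) e - ak e.
have nu0 e : 0 <= nu e by rewrite subr_ge0 an.
have delta0 : 0 <= delta.
  by rewrite -lee_fin (le_trans _ Hn)//; apply: esum_ge0.
have mU : measurable [set z | percolates 0 (un z)].
  exact: measurable_preimage measurable_union_config (measurable_percolates 0).
have mf : measurable_fun setT (fun z : config d * config d =>
    (id z.1, restrict (near_edges k) z.2)).
  apply: measurable_fun_pair; first exact: measurable_fst.
  apply: measurableT_comp; first exact: measurable_restrict.
  exact: measurable_snd.
have nuE : ((perc ak \x perc (restrict_weight (near_edges k) nu))%E good <=
    (theta (beta_ n) (J_ n))%:E)%E.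
  have -> : (theta (beta_ n) (J_ n))%:E =
      (perc ak \x perc nu)%E [set z | percolates 0 (un z)].
    rewrite (perc_union ak0 nu0 (measurable_percolates 0)) (theta_bond bn (hJ_ n)).
    by congr (perc _ _); apply/funext => e; rewrite /nu addrC subrK.
  have <- := product_law_image (@measurable_id _ _ setT)
    (measurable_restrict (near_edges k)) (fun A _ => erefl (perc ak A))
    (fun A mA => perc_restrict (near_edges k) nu0 mA) measurable_good.
  apply: le_measure; rewrite ?inE; [exact: measurable_preimage mf measurable_good|exact: mU|].
  move=> [w h] /= [x x0 px].
  have {}x0 : connected_in (union_config w h) 0 x.
    apply: connected_mono x0 => e; rewrite /un /union_config /= => /orP[->//|/andP[_ ->]].
    by rewrite orbT.
  apply: percolates_connected (connected_sym x0) _.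
  by apply: percolates_mono px => e /= we; rewrite /union_config we.
rewrite EFinD; apply: le_trans (leeD2r _ nuE).
apply: le_product_sectionD measurable_good _ => [|w].
  by rewrite mulrn_wge0 ?mulr_ge0.
apply: (@perc_touch_le _ _ _ _ (fun z => `|beta_ n * J_ n z - beta * J z|)
  _ _ _ _ bk0 nu0 (fun z => normr_ge0 _) _ _ Hn (measurable_xsection w measurable_good)).
- move=> e x y exy; rewrite /long_weight /nu opprB addrA subrK distrC.
  by rewrite (bondE _ (hJ_ n) exy) (bondE _ hJ exy).
- by move=> e /andP[].
Qed.

Let Q_good_at k : Q (good_at k) =
  (perc (restrict_weight (@short R d k) a) \x
     perc (restrict_weight (near_edges k) (long_weight k)))%E good.
Proof.
have <- : restrict_weight (near_edges k) b =
    restrict_weight (near_edges k) (long_weight k).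
  apply/funext => e; rewrite /restrict_weight; case: ifP => // /andP[_ ke].
  by rewrite /long_weight /restrict_weight ke /a /b /bond mulrBl.
exact: (product_law_image (measurable_restrict (@short R d k))
  (measurable_restrict (near_edges k)) (fun A mA => perc_restrict (@short R d k) a0 mA)
  (fun A mA => perc_restrict (near_edges k) b0 mA) measurable_good).
Qed.

Lemma theta_lower (eps : R) : 0 < eps ->
  \forall n \near \oo, theta beta J - eps <= theta (beta_ n) (J_ n).
Proof.
move=> eps0; have e2 : 0 < eps / 2 by rewrite divr_gt0.
have [k] := good_near e2; rewrite [X in (X + _)%E]Q_good_at => hk.
have [delta delta0 kdelta] := small_multiple k e2.
have H1 := L1_dist_near delta0; have H2 := short_near k.
near=> n.
have : ((perc (restrict_weight (@short R d k) a) \x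
      perc (restrict_weight (near_edges k) (long_weight k)))%E good <=
    (theta (beta_ n) (J_ n) + k%:R * delta *+ 2)%:E)%E.
  by apply: perc_good_le; near: n.
move=> /(leeD2r (eps / 2)%:E)/(le_trans hk); rewrite -EFinD lee_fin.
move: kdelta; lra.
Unshelve. all: by end_near. Qed.

End lower.

End convergence.

Lemma theta_ge0 (R : realType) (d : nat) (b : R) (K : lattice d -> R) : 0 <= theta b K.
Proof. by apply: fine_ge0; exact: measure_ge0. Qed.

Unset Implicit Arguments.

Theorem corollary1p7 (R : realType) (d : nat) (hd : (2 <= d)%N)
  (J : lattice d -> R) (hJ : is_kernel J)
  (hirr : irreducible J) (hres : resilient J)
  (beta : R) (hbeta0 : 0 <= beta) (hbeta : beta%:E <> beta_c J)
  (J_ : nat -> lattice d -> R) (hJ_ : forall n, is_kernel (J_ n))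
  (hJcvg : cvg_L1 J_ J)
  (beta_ : nat -> R) (hbeta_ : forall n, 0 < beta_ n)
  (hbetacvg : beta_ n @[n --> \oo] --> beta) :
  theta (beta_ n) (J_ n) @[n --> \oo] --> theta beta J.
Proof.
apply/cvgrPdist_le => eps eps0.
have lower : \forall n \near \oo, theta beta J - eps <= theta (beta_ n) (J_ n).
  have [bc|] := ltP (beta_c J) beta%:E; last first.
    rewrite le_eqVlt => /orP[/eqP//|bc].
    (* Below the critical value [theta beta J] vanishes, and nonnegativity of [theta] suffices. *)
    have theta0 : theta beta J <= 0.
      rewrite leNgt; apply/negP => pos; move: bc; rewrite ltNge => /negP; apply.
      by apply: ereal_inf_lbound; exists beta.
    near=> n; apply: (le_trans _ (theta_ge0 (beta_ n) (J_ n))).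
    by rewrite subr_le0 (le_trans theta0)// ltW.
  have [_ [b [b0 thetab] <-]] := ereal_inf_lt bc; rewrite lte_fin => bbeta.
  (* [b] could equal the critical value, while resilience asks for a strict inequality; the midpoint
     of [b] and [beta] provides it, and is positive and below [beta]. *)
  have b'pos : 0 < (b + beta) / 2 by lra.
  have b'beta : (b + beta) / 2 < beta by lra.
  have bcb' : (beta_c J < ((b + beta) / 2)%:E)%E.
    apply: (@le_lt_trans _ _ b%:E); last by rewrite lte_fin; lra.
    by apply: ereal_inf_lbound; exists b.
  have [N thetaN] := hres _ bcb'.
  exact: (theta_lower hJ hJ_ hbeta0 hbeta_ hJcvg hbetacvg b'pos b'beta hirr thetaN eps0).
have upper := theta_upper hJ hJ_ hbeta0 hbeta_ hJcvg hbetacvg eps0.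
near=> n; rewrite ler_distlC; apply/andP; split; near: n; [exact: lower|exact: upper].
Unshelve. all: by end_near. Qed.
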